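(* Consider a two-color balanced affine tenable triangular urn model with sample size $m\ge1$ ($a_m=0$, $c:=a_{m-1}>0$, $\sigma\ge mc$), under either sampling model $\mathcal M$ or $\mathcal R$, with coefficients $f_{n,s,r}$ and $\varphi_{n,s,k}$ as defined in the context. Then for all integers $s\ge1$ and $n\ge0$ $$\mathbb E[W_n^s]=\sum_{k=1}^{s}\varphi_{n,s,k}W_0^k.$$ Moreover, for every integer $s\ge1$, the limit $E_s=\lim_{n\to\infty}\mathbb E\big[(W_n/n^{\Lambda})^s\big]$ can be expressed as $$E_s=\begin{cases}\displaystyle\bigg(\prod_{\ell=1}^{s^*}\frac{\Gamma(\frac{T_0+1-\ell}{\sigma})}{\Gamma(\lambda_{\ell,s})}\bigg)\sum_{k=1}^{s}\tilde\varphi_{s,k}W_0^k,&\text{model }\mathcal M,\\[3mm]\displaystyle\frac{\Gamma(\frac{T_0}{\sigma})^s}{\prod_{\ell=1}^{s}\Gamma(\mu_{\ell,s})}\sum_{k=1}^{s}\tilde\varphi_{s,k}W_0^k,&\text{model }\mathcal R,\end{cases}$$ with $\tilde\varphi_{s,k}=\lim_{n\to\infty}\frac{\varphi_{n,s,k}}{\varphi_{n,s,s}}$. Here $\tilde\varphi_{s,s}=1$, and for $1\le k\le s-1$ the values $\tilde\varphi_{s,k}$ are given by the convergent infinite sums $$\tilde\varphi_{s,k}=\sum_{\ell=1}^{s-k}\ \sum_{\substack{h_1+\dots+h_\ell=s-k\\ h_\nu\ge1}}\bigg[\sum_{1\le i_\ell<\dots<i_1<\infty}f_{i_1,s,s-H_1}\,\frac{\prod_{g=2}^{\ell+1}\Big(f_{i_g,s-H_{g-1},s-H_g}\prod_{j=i_g+1}^{i_{g-1}-1}f_{j,s-H_{g-1},s-H_{g-1}}\Big)}{\prod_{j=1}^{i_1}f_{j,s,s}}\bigg],$$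 where $H_q=\sum_{\nu=1}^{q}h_\nu$, $H_0=0$, $i_{\ell+1}=0$, and a factor $f_{0,\cdot,\cdot}$ (occurring for $g=\ell+1$) is read as $1$.
   Context: Urn model. Fix integers $m\ge1$ and $\sigma\ge1$. An urn contains white and black balls; $W_n$ and $B_n$ denote their numbers after $n$ draws ($W_0,B_0$ nonrandom), and $T_n=W_n+B_n$. At each step a sample of $m$ balls is drawn, its colors are observed, and the sample is returned to the urn; if the sample has $k$ white and $m-k$ black balls, then $a_{m-k}$ white and $b_{m-k}$ black balls are added, $0\le k\le m$. The triangular balanced affine model has $a_{m-k}=kc$ and $b_{m-k}=\sigma-kc$ for $0\le k\le m$, with integers $c=a_{m-1}>0$, $\sigma\ge mc$ (so $a_m=0$). Then $T_n=T_0+\sigma n$. Standing assumption: $T_0\ge m$. Sampling. Given the first $n-1$ draws, the probability that the $n$th sample has exactly $k$ white balls is $\binom{W_{n-1}}{k}\binom{B_{n-1}}{m-k}/\binom{T_{n-1}}{m}$ in model $\mathcal M$ (without replacement) and $\binom mk W_{n-1}^kB_{n-1}^{m-k}/T_{n-1}^m$ in model $\mathcal R$ (with replacement). Notation: $\Lambda=\frac{mc}{\sigma}$, $C=\frac{\Lambda\sigma}{m}=c$, $s^*=\min\{s,m\}$. ${s\brace k}$ are the Stirling numbers of the second kind, ${s\brack k}$ the unsigned Stirling numbers of the first kind, $x^{\underline{k}}=x(x-1)\cdots(x-k+1)$. Coefficients $f$. For $n\ge1$ and $1\le r\le s$ (with $a_m=0$), $$f_{n,s,r}=\sum_{j=s-r}^{s}\binom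 sj\frac{\Lambda^j\sigma^j}{m^j}\,p_{n;(j,\,j-(s-r))},$$ where, with $i^*=\min\{i,m\}$, $p_{n;(i,\ell)}=\sum_{h=\ell}^{i^*}(-1)^{h-\ell}{h\brack\ell}{i\brace h}\binom mh/\binom{T_{n-1}}{h}$ for model $\mathcal M$ and $p_{n;(i,\ell)}={i\brace\ell}\,m^{\underline{\ell}}/T_{n-1}^{\ell}$ for model $\mathcal R$. Coefficients $\varphi$. $\varphi_{n,s,s}=\prod_{j=1}^nf_{j,s,s}$ and, for $1\le k\le s-1$, $$\varphi_{n,s,k}=\sum_{\ell=1}^{s-k}\ \sum_{\substack{h_1+\dots+h_\ell=s-k\\ h_\nu\ge1}}\bigg[\sum_{1\le i_\ell<\dots<i_1\le n}\prod_{g=1}^{\ell+1}\Big(f_{i_g,s-H_{g-1},s-H_g}\prod_{j=i_g+1}^{i_{g-1}-1}f_{j,s-H_{g-1},s-H_{g-1}}\Big)\bigg],$$ with $H_q=\sum_{\nu=1}^qh_\nu$, $H_0=0$, $i_0=n+1$, $i_{\ell+1}=0$, and $f_{0,\cdot,\cdot}$ read as $1$. Roots. $\lambda_{1,s},\dots,\lambda_{s^*,s}$ are the negated complex roots (with multiplicity) of the monic polynomial $P_s(x)=\frac{s^*!}{\sigma^{s^*}}\sum_{\ell=0}^{s^*}\frac{\binom s\ell}{\binom{s^*}\ell}C^\ell\binom m\ell\binom{x\sigma+T_0-\ell}{s^*-\ell}=\prod_{\ell=1}^{s^*}(x+\lambda_{\ell,s})$. $\mu_{1,s},\dots,\mu_{s,s}$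 are the negated complex roots (with multiplicity) of the monic polynomial $Q_s(x)=\frac1{\sigma^s}\sum_{\ell=0}^s\binom s\ell C^\ell\binom m\ell\ell!\,(x\sigma+T_0)^{s-\ell}=\prod_{\ell=1}^{s}(x+\mu_{\ell,s})$. *)

(* Defs.v *)
(* MathComp and MathComp-Analysis, with R[i] from mathcomp-real-closed. *)
From HB Require Import structures.
From mathcomp Require Export all_boot all_order all_algebra.
From mathcomp Require Export complex.
From mathcomp Require Export all_classical all_reals all_analysis.

Set Implicit Arguments.
Unset Strict Implicit.
Unset Printing Implicit Defensive.

Export Order.TTheory GRing.Theory Num.Theory.
Export numFieldNormedType.Exports.

Open Scope classical_set_scope.
Open Scope ring_scope.

Fixpoint stirling1 (n k : nat) : nat :=
  match n, k with
  | 0, 0 => 1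
  | n'.+1, k'.+1 => n' * stirling1 n' k'.+1 + stirling1 n' k'
  | _, _ => 0
  end%N.

Fixpoint stirling2 (n k : nat) : nat :=
  match n, k with
  | 0, 0 => 1
  | n'.+1, k'.+1 => k'.+1 * stirling2 n' k'.+1 + stirling2 n' k'
  | _, _ => 0
  end%N.

(* [ModelM]: sampling without replacement; [ModelR]: with replacement. *)
Inductive sampling_model := ModelM | ModelR.

Section UrnProcess.
Variables (smp : sampling_model) (m c sigma W0 B0 : nat).

(* [added_white j] and [added_black j] are the numbers a_j and b_j of balls
   added when the sample contains j black balls. *)
Definition added_white (j : nat) : nat := ((m - j) * c)%N.
Definition added_black (j : nat) : nat := (sigma - (m - j) * c)%N.

(* Contents (white, black) of the urn after n draws, where x i is the number of
   white balls in the i-th sample; draws are numbered from 1, so that x 0 is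
   irrelevant. *)
Fixpoint urn (x : nat -> nat) (n : nat) : nat * nat :=
  if n is n'.+1 then
    let wb := urn x n' in
    ((wb.1 + added_white (m - x n))%N, (wb.2 + added_black (m - x n))%N)
  else (W0, B0).

Variable R : realType.

Definition sample_prob (w b k : nat) : R :=
  match smp with
  | ModelM => 'C(w, k)%:R * 'C(b, m - k)%:R / 'C(w + b, m)%:R
  | ModelR => 'C(m, k)%:R * w%:R ^+ k * b%:R ^+ (m - k) / (w + b)%:R ^+ m
  end.

(* The conditional law of the n-th draw given the first n - 1 draws is stated
   in product form; for a history of probability 0 the equation is void. *)
Definition urn_draws (d : measure_display) (Omega : measurableType d)
    (P : probability Omega R) (K : nat -> {RV P >-> nat}) : Prop :=
  (forall n omega, (0 < n)%N -> (K n omega <= m)%N) /\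
  (forall (n : nat) (x : nat -> nat) (k : nat), (0 < n)%N -> (k <= m)%N ->
     let history :=
       [set omega | forall i, (0 < i < n)%N -> K i omega = x i] in
     P (history `&` [set omega | K n omega = k]) =
     (P history *
      (sample_prob (urn x n.-1).1 (urn x n.-1).2 k)%:E)%E).

End UrnProcess.

Section Coefficients.
Variables (R : realType) (smp : sampling_model) (m c sigma T0 : nat).

Definition Lambda : R := (m * c)%:R / sigma%:R.

Definition total (n : nat) : nat := (T0 + sigma * n)%N.

Definition p_coef (n i l : nat) : R :=
  match smp with
  | ModelM =>
      \sum_(l <= h < (minn i m).+1)
        (-1) ^+ (h - l) * (stirling1 h l)%:R * (stirling2 i h)%:R *
        ('C(m, h)%:R / 'C(total n.-1, h)%:R)
  | ModelR =>
      (stirling2 i l)%:R * (m ^_ l)%:R / (total n.-1)%:R ^+ l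
  end.

(* f_{n,s,r}, including the convention that f_{0,.,.} is read as 1. *)
Definition f_coef (n s r : nat) : R :=
  if n is 0 then 1 else
  \sum_(s - r <= j < s.+1)
    'C(s, j)%:R * (Lambda ^+ j * sigma%:R ^+ j / m%:R ^+ j) *
    p_coef n j (j - (s - r)).

(* H_q for the composition h = (h_1, ..., h_l). *)
Definition psum (h : seq nat) (q : nat) : nat := sumn (take q h).

(* (h_1, ..., h_l) is a composition of t (into l = size h positive parts). *)
Definition is_composition (t : nat) (h : seq nat) : bool :=
  all (fun x => 0 < x)%N h && (sumn h == t).

(* For i = (i_1, ..., i_l): 1 <= i_l < ... < i_1. *)
Definition is_decreasing (i : seq nat) : bool :=
  all (fun x => 0 < x)%N i && sorted (fun x y => y < x)%N i.

(* i_g for 0 <= g <= l + 1, with i_0 = n + 1 and i_{l+1} = 0 (the default of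
   [nth]). *)
Definition index_at (n : nat) (i : seq nat) (g : nat) : nat :=
  nth 0%N (n.+1 :: i) g.

Definition phi_factor (s : nat) (h i : seq nat) (n g : nat) : R :=
  f_coef (index_at n i g) (s - psum h g.-1) (s - psum h g) *
  \prod_((index_at n i g).+1 <= j < index_at n i g.-1)
    f_coef j (s - psum h g.-1) (s - psum h g.-1).

(* Parts of compositions of s - k and indices i_g <= n range over ordinals to
   make the sums finite. *)
Definition phi (n s k : nat) : R :=
  if k == s then \prod_(1 <= j < n.+1) f_coef j s s else
  \sum_(1 <= l < (s - k).+1)
    \sum_(h : l.-tuple 'I_(s - k).+1 | is_composition (s - k) (map val h))
      \sum_(i : l.-tuple 'I_n.+1 | is_decreasing (map val i))
        \prod_(1 <= g < l.+2) phi_factor s (map val h) (map val i) n g.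

Definition phi_lim (s k : nat) : R :=
  limn (fun n => phi n s k / phi n s s).

(* For g >= 2 the value of [phi_factor] does not depend on its argument n,
   which only serves as i_0 = n + 1. *)
Definition phi_lim_term (s : nat) (h i : seq nat) : R :=
  f_coef (index_at 0 i 1) s (s - psum h 1) *
  ((\prod_(2 <= g < (size i).+2) phi_factor s h i 0 g) /
   \prod_(1 <= j < (index_at 0 i 1).+1) f_coef j s s).

End Coefficients.

(* Sum of an absolutely summable real family. *)
Definition unordered_sum (R : realType) (I : choiceType) (D : set I)
    (u : I -> R) : R :=
  fine (\esum_(i in D) (EFin \o u)^\+ i - \esum_(i in D) (EFin \o u)^\- i)%E.

Section RootPolynomials.
Variables (F : fieldType) (m c sigma T0 : nat).

(* The generalized binomial coefficient binom(p, k) for a polynomial p. *)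
Definition binom_poly (p : {poly F}) (k : nat) : {poly F} :=
  (k`!%:R)^-1 *: \prod_(0 <= i < k) (p - i%:R%:P).

Definition P_poly (s : nat) : {poly F} :=
  let s' := minn s m in
  (s'`!%:R / sigma%:R ^+ s') *:
  \sum_(0 <= l < s'.+1)
    ('C(s, l)%:R / 'C(s', l)%:R * c%:R ^+ l * 'C(m, l)%:R) *:
    binom_poly ('X * sigma%:R%:P + T0%:R%:P - l%:R%:P) (s' - l).

Definition Q_poly (s : nat) : {poly F} :=
  (sigma%:R ^+ s)^-1 *:
  \sum_(0 <= l < s.+1)
    ('C(s, l)%:R * c%:R ^+ l * 'C(m, l)%:R * l`!%:R) *:
    ('X * sigma%:R%:P + T0%:R%:P) ^+ (s - l).

(* lam 1, ..., lam n are the negated roots of p, with multiplicity. *)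
Definition negated_roots (p : {poly F}) (n : nat) (lam : nat -> F) : Prop :=
  p = \prod_(1 <= l < n.+1) ('X + (lam l)%:P).

End RootPolynomials.

Section ComplexGamma.
Variable R : realType.

(* x ^ z = exp (z ln x) for real x > 0 and complex z. *)
Definition cpow (x : R) (z : R[i]) : R[i] :=
  (expR (complex.Re z * ln x))%:C%C *
  Complex (cos (complex.Im z * ln x)) (sin (complex.Im z * ln x)).

Definition gamma_seq (z : R[i]) (n : nat) : R[i] :=
  n`!%:R * cpow n%:R z / \prod_(0 <= i < n.+1) (z + i%:R).

(* Euler's limit formula, which defines the Gamma function on all complex
   numbers except 0, -1, -2, ...; limits in R[i] are taken componentwise. *)
Definition Gamma (z : R[i]) : R[i] :=
  Complex (limn (fun n => complex.Re (gamma_seq z n)))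
          (limn (fun n => complex.Im (gamma_seq z n))).

End ComplexGamma.

(* Main.v *)
Require Import Defs.
From mathcomp Require Import zify ring lra measurable_realfun.

Set Implicit Arguments.
Unset Strict Implicit.
Unset Printing Implicit Defensive.

(** Why the theorem holds.

    Given an urn with [w] white balls, the number [k] of white balls in the next
    sample is hypergeometric or binomial, and its factorial moments are explicit.
    Stirling numbers turn them into power moments, and [E (w + c k) ^ s] becomes
    the polynomial [\sum_r f_{n,s,r} w ^ r] ([sum_sample_step]). Hence the moments
    satisfy the triangular linear recursion
    [E W_n^s = \sum_(r <= s) f_{n,s,r} E W_{n-1}^r] ([expectation_white] and
    [white_mean_expr]).

    Let [D_s(n)], [diag_prod s n] below, be the product of the diagonal coefficients
    [f_{j,s,s}]. Dividing the [s]-th moment by [D_s] removes the diagonal part of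
    the recursion: what remains are jumps from [s] to [r < s] at time [i], with
    weight [f_{i,s,r} D_r(i-1) / D_s(i)]. Summing over all chains of jumps from [s]
    to [k] gives [phi n s k / D_s(n)]; the compositions in the definition of [phi]
    are the jump sizes, the decreasing indices are the jump times
    ([prod_phi_factor], [phi_psi], [psi_recr]).

    For the limits, [|f_{n,s,r}|] is at most a constant times
    [f_{n,s,s} - f_{n,r,r}]: the former is at most and the latter at least of order
    [1 / n]. So the jump weight at time
    [i] is bounded by a constant times the decrease of [D_r / D_s] at [i], and the
    weights are absolutely summable because these decreases telescope
    ([sum_jump_bound]). The sums over chains then converge to the infinite sums of
    the statement ([cvg_sum_decreasing], [phi_lim_term_limit]).

    It remains to see that [D_s(n)] grows like [n ^ (s Lambda)]. In either model
    [f_{n+1,s,s}] is the value at [n] of the root polynomial divided by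
    [\prod_i (n + t_i)] with explicit shifts [t_i], so [D_s(n)] is a quotient of rising
    products, that is, of the sequences defining the Gamma function at the [t_i] and
    at the negated roots ([prod_gamma_seq]). The subleading coefficient of
    the root polynomial shows that the exponents of [n] add up to [s Lambda]. Euler's
    sequence has a nonzero limit at each of these points, since the quotients of its
    consecutive terms are [1 + O(1 / n ^ 2)] ([Gamma_limit]). *)

(** * Stirling numbers and the factorial moments of one sample *)

Lemma stirling2_small j h : (j < h)%N -> stirling2 j h = 0%N.
Proof.
elim: j h => [|j IH] [|h] //= jh.
by rewrite !IH ?muln0 //; lia.
Qed.

Lemma stirling2_n0 j : (0 < j)%N -> stirling2 j 0 = 0%N.
Proof. by case: j. Qed.

Lemma stirling1_n0 h : (0 < h)%N -> stirling1 h 0 = 0%N.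
Proof. by case: h. Qed.

Lemma stirling1_small h l : (h < l)%N -> stirling1 h l = 0%N.
Proof.
elim: h l => [|h IH] [|l] //= hl.
by rewrite !IH ?muln0 //; lia.
Qed.

Lemma stirling1_nn h : stirling1 h h = 1%N.
Proof. by elim: h => //= h ->; rewrite stirling1_small // muln0. Qed.

Lemma stirling2_nn h : stirling2 h h = 1%N.
Proof. by elim: h => //= h ->; rewrite stirling2_small // muln0. Qed.

(** Induction on [j]: multiplying [k ^_ h] by [k = h + (k - h)] keeps it with
    weight [h] and moves it to [k ^_ h.+1] with weight 1, which is the recurrence
    of [stirling2]. *)
Lemma expn_ffact_stirling2 k j :
  (k ^ j = \sum_(h < j.+1) stirling2 j h * k ^_ h)%N.
Proof.
elim: j => [|j IH]; first by rewrite big_ord1.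
rewrite expnS IH big_distrr /=.
rewrite [in RHS]big_ord_recl /= mul0n add0n.
under eq_bigr => h _.
  have -> : (k * (stirling2 j h * k ^_ h) =
             h * stirling2 j h * k ^_ h + stirling2 j h * k ^_ h.+1)%N.
    rewrite ffactnSr; case: (leqP h k) => hk; last by rewrite ffact_small //; lia.
    have -> : k = (h + (k - h))%N by lia.
    by rewrite addKn; lia.
  over.
rewrite big_split /=.
under [in RHS]eq_bigr => h _ do rewrite /bump /= add1n mulnDl.
rewrite [in RHS]big_split /=; congr addn.
rewrite big_ord_recl /= mul0n add0n.
rewrite [in RHS]big_ord_recr /= stirling2_small ?muln0 ?mul0n ?addn0 //.
Qed.

Section Ring.
Variable R : comNzRingType.

(** For [w < h] both sides vanish, so that no truncated subtraction is seen. *)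
Lemma ffact_expr_stirling1 (w h : nat) :
  ((w ^_ h)%:R : R) =
  \sum_(l < h.+1) (-1) ^+ (h - l) * (stirling1 h l)%:R * w%:R ^+ l.
Proof.
elim: h => [|h IH]; first by rewrite big_ord1 /= expr0 !mulr1.
have -> : ((w ^_ h.+1)%:R : R) = (w ^_ h)%:R * (w%:R - h%:R).
  rewrite ffactnSr natrM; case: (leqP h w) => hw; first by rewrite natrB.
  by rewrite ffact_small // !mul0r.
rewrite IH mulrBr.
rewrite [in RHS]big_ord_recl /= mulr0 mul0r add0r.
under [in RHS]eq_bigr => l _.
  rewrite /bump /= add1n subSS natrD mulrDr mulrDl.
  over.
rewrite [in RHS]big_split /= [in RHS]addrC; congr (_ + _).
  rewrite mulr_suml; apply: eq_bigr => l _; rewrite add0n exprSr; ring.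
rewrite mulr_suml big_ord_recl /=.
rewrite [in RHS]big_ord_recr /= add0n (stirling1_small (ltnSn h)) muln0 mulr0 mul0r addr0.
case: h IH => [|h] IH.
  by rewrite !big_ord0 ?mul0n ?mulr0n !(mulr0, mul0r, oppr0, addr0).
rewrite /= mulr0 !mul0r add0r -sumrN; apply: eq_bigr => l _.
rewrite /bump /= !add1n.
have -> : (h.+1 - l = (h.+1 - l.+1).+1)%N by have := ltn_ord l; lia.
rewrite natrM [(-1) ^+ _.+1]exprS; ring.
Qed.
End Ring.

Lemma ffact_bin h n k : (h <= k)%N ->
  (k ^_ h * 'C(n, k) = n ^_ h * 'C(n - h, k - h))%N.
Proof.
elim: h n k => [|h IH] n k; first by rewrite !ffactn0 !mul1n !subn0.
case: k => // k hk.
case: n => [|n]; first by rewrite bin0n ffact0n /= muln0.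
by rewrite !ffactSS !subSS mulnAC -mul_bin_diag /= -mulnA [X in (_ * X)%N]mulnC IH // mulnA.
Qed.

Lemma sum_ffact_shift (R : comNzRingType) m h (F : nat -> R) : (h <= m)%N ->
  \sum_(k < m.+1) (k ^_ h)%:R * F k =
  \sum_(k < (m - h).+1) ((k + h) ^_ h)%:R * F (k + h)%N.
Proof.
move=> hm.
rewrite -!(big_mkord xpredT (fun k => ((k + _) ^_ h)%:R * F (k + _)%N)).
rewrite -(big_mkord xpredT (fun k => (k ^_ h)%:R * F k)).
rewrite (big_cat_nat (n := h)) //=; last by lia.
rewrite big_nat_cond big1 ?add0r; last first.
  by move=> k /andP[/andP[_ kh] _]; rewrite ffact_small // mul0r.
by rewrite -{1}[h]add0n big_addn -subSn.
Qed.

Section Moments.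
Variables (R : realType) (m : nat).

(** The [h]-th factorial moment of the number of white balls in a sample of size
    [m] from an urn of [w] white balls among [T]. *)
Definition fact_moment (smp : sampling_model) (T w h : nat) : R :=
  match smp with
  | ModelM => 'C(m, h)%:R / 'C(T, h)%:R * (w ^_ h)%:R
  | ModelR => (m ^_ h)%:R / T%:R ^+ h * w%:R ^+ h
  end.

(** [k ^_ h] turns ['C(w, k)] into [w ^_ h * 'C(w - h, k - h)], after which
    Vandermonde's convolution sums the sample weights. *)
Lemma sum_ffact_hypergeometric w b h : (m <= w + b)%N ->
  \sum_(k < m.+1) (k ^_ h)%:R * sample_prob ModelM m R w b k =
  fact_moment ModelM (w + b) w h.
Proof.
move=> mT; rewrite /sample_prob /fact_moment.
case: (leqP h m) => hm; last first.
  rewrite (bin_small hm) mul0r mul0r big1 // => k _.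
  by rewrite ffact_small ?mul0r //; have := ltn_ord k; lia.
rewrite (@sum_ffact_shift _ m h
  (fun k => 'C(w, k)%:R * 'C(b, m - k)%:R / 'C(w + b, m)%:R)) //.
under eq_bigr => k _.
  rewrite !mulrA -natrM ffact_bin ?leq_addl // addnK subnDA subnAC.
  rewrite natrM -!mulrA.
  over.
rewrite -mulr_sumr [RHS]mulrC.
case: (leqP h w) => hw; last by rewrite (ffact_small hw) !mul0r.
congr (_ * _).
under eq_bigr => k _ do rewrite mulrA.
rewrite -mulr_suml.
have -> : \sum_(i < (m - h).+1) 'C(w - h, i)%:R * 'C(b, m - h - i)%:R =
          'C(w + b - h, m - h)%:R :> R.
  rewrite -addnBAC // -binomial.Vandermonde natr_sum; apply: eq_bigr => k _.
  by rewrite natrM.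
have C1 : 'C(w + b, m)%:R != 0 :> R by rewrite pnatr_eq0 -lt0n bin_gt0.
have C2 : 'C(w + b, h)%:R != 0 :> R.
  by rewrite pnatr_eq0 -lt0n bin_gt0 (leq_trans hm).
apply/eqP; rewrite eqr_div // -!natrM; apply/eqP; congr (_%:R).
apply/eqP; rewrite -(eqn_pmul2r (fact_gt0 h)); apply/eqP.
rewrite -[LHS]mulnA bin_ffact mulnC -ffact_bin //.
by rewrite mulnAC bin_ffact.
Qed.

(** Same absorption of [k ^_ h], with the binomial theorem in place of
    Vandermonde's convolution. *)
Lemma sum_ffact_binomial w b h : (0 < w + b)%N ->
  \sum_(k < m.+1) (k ^_ h)%:R * sample_prob ModelR m R w b k =
  fact_moment ModelR (w + b) w h.
Proof.
move=> T0; rewrite /sample_prob /fact_moment.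
case: (leqP h m) => hm; last first.
  rewrite (ffact_small hm) mul0r mul0r big1 // => k _.
  by rewrite ffact_small ?mul0r //; have := ltn_ord k; lia.
rewrite (@sum_ffact_shift _ m h (fun k =>
  'C(m, k)%:R * w%:R ^+ k * b%:R ^+ (m - k) / (w + b)%:R ^+ m)) //.
have T1 : (w + b)%:R != 0 :> R by rewrite pnatr_eq0 -lt0n.
have -> : (w + b)%:R ^+ m = (w + b)%:R ^+ h * (w + b)%:R ^+ (m - h) :> R.
  by rewrite -exprD subnKC.
under eq_bigr => k _.
  rewrite !mulrA -natrM ffact_bin ?leq_addl // addnK subnDA subnAC.
  rewrite natrM exprD.
  have -> : (m ^_ h)%:R * 'C(m - h, k)%:R * (w%:R ^+ k * w%:R ^+ h) *
      b%:R ^+ (m - h - k) / ((w + b)%:R ^+ h * (w + b)%:R ^+ (m - h)) =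
    ((m ^_ h)%:R / (w + b)%:R ^+ h * w%:R ^+ h / (w + b)%:R ^+ (m - h)) *
      ('C(m - h, k)%:R * w%:R ^+ k * b%:R ^+ (m - h - k)) :> R.
    by field; rewrite !expf_neq0.
  over.
rewrite -mulr_sumr.
have -> : \sum_(i < (m - h).+1) 'C(m - h, i)%:R * w%:R ^+ i * b%:R ^+ (m - h - i) =
          (w + b)%:R ^+ (m - h) :> R.
  rewrite natrD [X in _ = X ^+ _]addrC exprDn; apply: eq_bigr => i _.
  by rewrite -mulr_natl; ring.
by rewrite divfK // expf_neq0.
Qed.

Lemma sum_ffact_sample smp w b h : (1 <= m)%N -> (m <= w + b)%N ->
  \sum_(k < m.+1) (k ^_ h)%:R * sample_prob smp m R w b k =
  fact_moment smp (w + b) w h.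
Proof.
case: smp => m0 mT; first exact: sum_ffact_hypergeometric.
by apply: sum_ffact_binomial; lia.
Qed.
End Moments.

(** * The conditional moments of one draw are polynomials with coefficients f *)

Section OneStep.
Variables (R : realType) (smp : sampling_model) (m c sigma T0 : nat).
Hypotheses (hm : (1 <= m)%N).

Let p := p_coef R smp m sigma T0.
Let f := f_coef R smp m c sigma T0.

(** [p_coef] collects the coefficients of [w ^+ l]: expanding [w ^_ h] for
    sampling without replacement, and directly for sampling with replacement. *)
Lemma sum_stirling_fact_moment n j (w : nat) :
  \sum_(h < j.+1)
     (stirling2 j h)%:R * fact_moment R m smp (total sigma T0 n.-1) w h =
  \sum_(l < j.+1) p n j l * w%:R ^+ l.
Proof.
rewrite /p /p_coef /fact_moment; case: smp; last first.
  by apply: eq_bigr => h _; ring.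
set T := total _ _ _.
under eq_bigr => h _ do rewrite ffact_expr_stirling1 !mulr_sumr.
under [in RHS]eq_bigr => l _ do rewrite mulr_suml.
under [in RHS]eq_bigr => l _ do rewrite big_geq_mkord /=.
rewrite (exchange_big_dep xpredT) //=.
pose G h : R := \sum_(i < h.+1) (stirling2 j h)%:R *
  ('C(m, h)%:R / 'C(T, h)%:R *
    ((-1) ^+ (h - i) * (stirling1 h i)%:R * w%:R ^+ i)).
transitivity (\sum_(h < (minn j m).+1) G h); last first.
  apply: eq_bigr => h _; rewrite /G.
  rewrite (big_ord_widen j.+1 (fun i => (stirling2 j h)%:R *
    ('C(m, h)%:R / 'C(T, h)%:R *
      ((-1) ^+ (h - i) * (stirling1 h i)%:R * w%:R ^+ i)))); last first.
    by have := ltn_ord h; lia.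
  by apply: eq_bigr => l _; ring.
rewrite (@big_ord_widen _ _ _ (minn j m).+1 j.+1 G); last by lia.
rewrite [in RHS]big_mkcond /=; apply: eq_bigr => h _; case: ifP => // hh.
apply: big1 => l _; rewrite (bin_small (n := m)) ?mul0r ?mulr0 //.
by have := ltn_ord h; lia.
Qed.

Lemma sum_expr_sample n j (w b : nat) : (m <= w + b)%N ->
  (w + b)%N = total sigma T0 n.-1 ->
  \sum_(k < m.+1) sample_prob smp m R w b k * k%:R ^+ j =
  \sum_(l < j.+1) p n j l * w%:R ^+ l.
Proof.
move=> mwb wb; rewrite -sum_stirling_fact_moment -wb.
under [in RHS]eq_bigr => h _ do rewrite -sum_ffact_sample // mulr_sumr.
rewrite exchange_big /=; apply: eq_bigr => k _.
rewrite -natrX expn_ffact_stirling2 natr_sum mulr_sumr; apply: eq_bigr => h _.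
by rewrite natrM; ring.
Qed.

Lemma p_coef_n0 n j : (0 < j)%N -> p n j 0 = 0.
Proof.
rewrite /p /p_coef; case: smp => j0; last by rewrite stirling2_n0 // !mul0r.
rewrite big_nat_recl // stirling2_n0 // mulr0 mul0r add0r big1 // => h _.
by rewrite stirling1_n0 // !(mulr0, mul0r).
Qed.

Lemma Lambda_exp j : (0 < sigma)%N ->
  Lambda R m c sigma ^+ j * sigma%:R ^+ j / m%:R ^+ j = c%:R ^+ j.
Proof.
move=> sg0; rewrite -exprMn -expr_div_n; congr (_ ^+ j); rewrite /Lambda natrM.
by field; rewrite !pnatr_eq0; lia.
Qed.

Lemma triangle_exchange (F : nat -> nat -> R) s :
  \sum_(j < s.+1) \sum_(l < j.+1) F j (s - j + l)%N =
  \sum_(r < s.+1) \sum_(s - r <= j < s.+1) F j r.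
Proof.
under [in RHS]eq_bigr => r _ do rewrite big_geq_mkord.
rewrite (exchange_big_dep xpredT) //=; apply: eq_bigr => j _.
have js := ltn_ord j.
rewrite -(big_mkord xpredT (fun l => F j (s - j + l)%N)).
rewrite -(big_mkord (fun i => (s - i <= j)%N) (fun i => F j i)).
rewrite [RHS](big_cat_nat (n := (s - j)%N)) //=; last by lia.
rewrite [X in _ = X + _]big_nat_cond [X in _ = X + _]big1 ?add0r; last first.
  by move=> i; lia.
rewrite -{2}[(s - j)%N]add0n big_addn.
have -> : (s.+1 - (s - j) = j.+1)%N by lia.
rewrite big_nat_cond [RHS]big_nat_cond; apply: eq_big => i; first by lia.
by rewrite addnC.
Qed.

(** Expand [(w + c k) ^+ s] binomially, take the moments of [k], and collect the
    powers of [w]. The constant term drops out because [p_coef] vanishes at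
    [l = 0 < j]. *)
Lemma sum_sample_step s n (w b : nat) :
  (0 < s)%N -> (0 < n)%N -> (0 < sigma)%N ->
  (m <= w + b)%N -> (w + b)%N = total sigma T0 n.-1 ->
  \sum_(k < m.+1) sample_prob smp m R w b k * (w + k * c)%:R ^+ s =
  \sum_(1 <= r < s.+1) f n s r * w%:R ^+ r.
Proof.
move=> s0 n0 sg0 mwb wb.
transitivity (\sum_(j < s.+1) \sum_(l < j.+1)
   'C(s, j)%:R * c%:R ^+ j * p n j l * w%:R ^+ (s - j + l)).
  under eq_bigr => k _.
    rewrite natrD natrM exprDn mulr_sumr.
    over.
  rewrite exchange_big /=; apply: eq_bigr => j _.
  transitivity ('C(s, j)%:R * c%:R ^+ j * w%:R ^+ (s - j) *
     \sum_(k < m.+1) sample_prob smp m R w b k * k%:R ^+ j).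
    rewrite mulr_sumr; apply: eq_bigr => k _.
    by rewrite -mulr_natl exprMn; ring.
  rewrite (sum_expr_sample j mwb wb) mulr_sumr; apply: eq_bigr => l _.
  by rewrite exprD; ring.
transitivity (\sum_(j < s.+1) \sum_(l < j.+1)
   'C(s, j)%:R * c%:R ^+ j * p n j (j - (s - (s - j + l))) *
   w%:R ^+ (s - j + l)).
  apply: eq_bigr => j _; apply: eq_bigr => l _.
  have -> // : (j - (s - (s - j + l)) = l)%N.
  by have := ltn_ord j; have := ltn_ord l; lia.
rewrite (triangle_exchange (fun j r =>
  'C(s, j)%:R * c%:R ^+ j * p n j (j - (s - r)) * w%:R ^+ r)).
rewrite -(big_mkord xpredT (fun r => \sum_(s - r <= j < s.+1)
  'C(s, j)%:R * c%:R ^+ j * p n j (j - (s - r)) * w%:R ^+ r)).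
rewrite big_ltn // subn0 big_nat1 subnn p_coef_n0 // mulr0 mul0r add0r.
apply: eq_bigr => r _; rewrite /f /f_coef; case: n n0 {mwb wb} => // n _.
by rewrite mulr_suml; apply: eq_bigr => j _; rewrite Lambda_exp.
Qed.
End OneStep.

(** * Diagonal coefficients and the size of the off-diagonal ones *)

(** With [t = diag_shift] and [a = diag_coef], both sampling models give
    [f_{n+1,s,s} = \sum_l a_l / \prod_(i < l) (n + t_i)]: the urn total [T_n] is
    [sigma (n + t_0)], and without replacement its falling factorial
    [T_n ^_ l] is [sigma ^+ l * \prod_(i < l) (n + t_i)]. The field is a variable
    because the root polynomials are taken over the complex numbers. *)
Definition diag_shift (F : fieldType) (smp : sampling_model)
    (sigma T0 i : nat) : F :=
  match smp with
  | ModelM => (T0%:R - i%:R) / sigma%:R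
  | ModelR => T0%:R / sigma%:R
  end.

Definition diag_coef (F : fieldType) (m c sigma s l : nat) : F :=
  'C(s, l)%:R * c%:R ^+ l * ('C(m, l)%:R * l`!%:R) / sigma%:R ^+ l.

Section Bounds.
Variables (R : realType) (smp : sampling_model) (m c sigma T0 : nat).
Hypotheses (hm : (1 <= m)%N) (hc : (0 < c)%N) (hs : (0 < sigma)%N).
Hypothesis hT : (m <= T0)%N.

Let p := p_coef R smp m sigma T0.
Let f := f_coef R smp m c sigma T0.
Let T n := total sigma T0 n.

Local Notation tau := (diag_shift R smp sigma T0).
Local Notation a_coef := (diag_coef R m c sigma).

Lemma total_ge n : (m <= T n)%N.
Proof. by rewrite /T /total; lia. Qed.

Lemma ler_bin_ratio h t : (0 < h)%N -> (h <= m)%N -> (m <= t)%N ->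
  'C(m, h)%:R / 'C(t, h)%:R <= m%:R / t%:R :> R.
Proof.
move=> h0 hhm mt.
rewrite ler_pdivrMr ?ltr0n ?bin_gt0; last by lia.
rewrite mulrAC ler_pdivlMr ?ltr0n; last by lia.
rewrite -!natrM ler_nat -(leq_pmul2l h0) mulnA.
case: h h0 hhm => // h _ hhm.
rewrite -mul_bin_diag [leqRHS]mulnCA -mul_bin_diag [leqRHS]mulnA mulnAC.
rewrite leq_pmul2l ?muln_gt0; last by lia.
by apply: leq_bin2l; lia.
Qed.

Definition p_bound (j l : nat) : R :=
  \sum_(h < m.+1) (stirling1 h l)%:R * (stirling2 j h)%:R * m%:R +
  (stirling2 j l)%:R * (m ^_ l)%:R.

Lemma p_bound_ge0 j l : 0 <= p_bound j l.
Proof.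
by apply: addr_ge0; rewrite ?mulr_ge0 ?sumr_ge0 // => h _; rewrite !mulr_ge0.
Qed.

(** Without replacement the term of index [h] is of order [T ^ -h], and with
    replacement the coefficient is of order [T ^ -l]; the value at [l = 0], which
    could be of order 1, vanishes for [j > 0]. *)
Lemma p_coef_bound n j l : (0 < j)%N ->
  `|p n.+1 j l| <= p_bound j l / (T n)%:R.
Proof.
move=> j0; have T1 : (0 < T n)%N by have := total_ge n; lia.
have [->|l0] := posnP l.
  by rewrite /p p_coef_n0 // normr0 divr_ge0 ?p_bound_ge0.
rewrite /p /p_coef /p_bound mulrDl; case: smp.
  apply: ler_wpDr; first by rewrite !mulr_ge0 ?invr_ge0.
  rewrite big_geq_mkord mulr_suml.
  apply: le_trans (ler_norm_sum _ _ _) _.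
  apply: (@le_trans _ _ (\sum_(h < (minn j m).+1)
      (stirling1 h l)%:R * (stirling2 j h)%:R * m%:R / (T n)%:R)).
    rewrite big_mkcond /=; apply: ler_sum => h _; case: ifP => hl; last first.
      by rewrite !mulr_ge0 ?invr_ge0.
    rewrite !normrM normrX normrN1 expr1n mul1r !normr_nat normfV normr_nat.
    rewrite -[leRHS]mulrA; apply: ler_wpM2l; first by rewrite mulr_ge0.
    by apply: ler_bin_ratio; rewrite ?total_ge //; have := ltn_ord h; lia.
  rewrite (@big_ord_widen _ _ _ (minn j m).+1 m.+1 (fun h =>
    (stirling1 h l)%:R * (stirling2 j h)%:R * m%:R / (T n)%:R)); last by lia.
  rewrite big_mkcond /=; apply: ler_sum => h _; case: ifP => //.
apply: ler_wpDl.
  by rewrite mulr_ge0 ?invr_ge0 ?sumr_ge0 // => h _; rewrite !mulr_ge0.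
rewrite !normrM normfV normrX !normr_nat; apply: ler_wpM2l; first by rewrite mulr_ge0.
rewrite lef_pV2 ?posrE ?exprn_gt0 ?ltr0n //.
by apply: ler_eXnr => //; rewrite ler1n.
Qed.

Definition f_bound (s r : nat) : R :=
  \sum_(s - r <= j < s.+1) 'C(s, j)%:R * c%:R ^+ j * p_bound j (j - (s - r)).

Lemma f_bound_ge0 s r : 0 <= f_bound s r.
Proof.
by apply: sumr_ge0 => j _; rewrite mulr_ge0 ?p_bound_ge0 // ?mulr_ge0.
Qed.

Lemma f_coef_bound n s r : (r < s)%N -> `|f n.+1 s r| <= f_bound s r / (T n)%:R.
Proof.
move=> rs; rewrite /f /f_coef /f_bound mulr_suml.
apply: le_trans (ler_norm_sum _ _ _) _.
rewrite big_nat_cond [leRHS]big_nat_cond.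
apply: ler_sum => j /andP[/andP[j1 j2] _].
rewrite Lambda_exp // -mulrA !normrM normrX !normr_nat -2!mulrA.
do 2 apply: ler_wpM2l => //.
by apply: p_coef_bound; lia.
Qed.

Lemma tau_gt0 i : (i < m)%N -> 0 < tau i.
Proof.
move=> im; rewrite /diag_shift; case: smp; rewrite divr_gt0 ?ltr0n //; last by lia.
by rewrite subr_gt0 ltr_nat; lia.
Qed.

Lemma p_diag n j :
  p n.+1 j j = 'C(m, j)%:R * j`!%:R / sigma%:R ^+ j / \prod_(i < j) (n%:R + tau i).
Proof.
have [jm|jm] := leqP j m; last first.
  rewrite bin_small // !mul0r /p /p_coef; case: smp; last first.
    by rewrite (ffact_small jm) mulr0 mul0r.
  by rewrite big_geq //; lia.
have E : sigma%:R ^+ j * (\prod_(i < j) (n%:R + tau i)) =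
  match smp with ModelM => 'C(T n, j)%:R * j`!%:R | ModelR => (T n)%:R ^+ j end.
  rewrite -[j in _ ^+ j]card_ord -prodr_const -big_split /= /diag_shift.
  have s0 : sigma%:R != 0 :> R by rewrite pnatr_eq0; lia.
  case: smp; last first.
    rewrite -[j in RHS]card_ord -prodr_const; apply: eq_bigr => i _.
    by rewrite /T /total natrD natrM; field.
  rewrite -natrM bin_ffact ffact_prod natr_prod; apply: eq_bigr => i _.
  have := total_ge n; have := ltn_ord i => ij mT.
  by rewrite natrB; [rewrite /T /total natrD natrM; field|lia].
rewrite -mulrA -invfM E /p /p_coef; case: smp {E}; last first.
  by rewrite stirling2_nn mul1r -natrM bin_ffact.
have -> : minn j m = j by lia.
rewrite big_nat1 subnn expr0 mul1r stirling1_nn stirling2_nn !mul1r.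
by rewrite -mulf_div divff ?mulr1 // pnatr_eq0 -lt0n fact_gt0.
Qed.

Lemma p_diag_ge0 n j : 0 <= p n.+1 j j.
Proof.
have [jm|jm] := leqP j m; last by rewrite p_diag bin_small // !mul0r.
rewrite p_diag; apply: divr_ge0; first by rewrite divr_ge0 ?exprn_ge0 // mulr_ge0.
apply: prodr_ge0 => i _; apply: addr_ge0 => //; apply/ltW/tau_gt0.
by have := ltn_ord i; lia.
Qed.

Lemma f_diag n s : f n.+1 s s = \sum_(j < s.+1) 'C(s, j)%:R * c%:R ^+ j * p n.+1 j j.
Proof.
rewrite /f /f_coef subnn big_mkord; apply: eq_bigr => j _.
by rewrite Lambda_exp // subn0.
Qed.

Lemma f_diag_a n s :
  f n.+1 s s = \sum_(j < s.+1) a_coef s j / \prod_(i < j) (n%:R + tau i).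
Proof.
rewrite f_diag; apply: eq_bigr => j _.
by rewrite p_diag /diag_coef; ring.
Qed.

Lemma f_diag_ge1 n s : 1 <= f n.+1 s s.
Proof.
rewrite f_diag big_ord_recl bin0 expr0 !mul1r.
have p00 : p n.+1 0 0 = 1 by rewrite p_diag big_ord0 bin0 fact0 expr0 !divr1 mulr1.
rewrite /= p00 lerDl.
apply: sumr_ge0 => j _; rewrite mulr_ge0 ?p_diag_ge0 // mulr_ge0 //.
Qed.

(** The term [j = 1] contributes [c m (s - r) / T]; the others are nonnegative. *)
Lemma f_diag_diff n s r : (r < s)%N -> (T n)%:R^-1 <= f n.+1 s s - f n.+1 r r.
Proof.
move=> rs; rewrite !f_diag.
rewrite (@big_ord_widen _ _ _ r.+1 s.+1 (fun j =>
  'C(r, j)%:R * c%:R ^+ j * p n.+1 j j)); last by lia.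
rewrite [X in _ - X]big_mkcond /= -sumrB.
rewrite -(big_mkord xpredT (fun i => 'C(s, i)%:R * c%:R ^+ i * p n.+1 i i -
  (if (i < r.+1)%N then 'C(r, i)%:R * c%:R ^+ i * p n.+1 i i else 0))).
rewrite (bigD1_seq 1%N) ?iota_uniq ?mem_index_iota //=; last by lia.
have E i : 'C(s, i)%:R * c%:R ^+ i * p n.+1 i i -
    (if (i < r.+1)%N then 'C(r, i)%:R * c%:R ^+ i * p n.+1 i i else 0) =
   ('C(s, i) - 'C(r, i))%:R * c%:R ^+ i * p n.+1 i i.
  case: ifP => hi; first by rewrite natrB ?leq_bin2l 1?ltnW //; ring.
  by rewrite [in RHS](bin_small (n := r)) ?subn0 ?subr0 //; lia.
rewrite ler_wpDr ?E //.
  apply: sumr_ge0 => i _; rewrite E mulr_ge0 ?p_diag_ge0 // mulr_ge0 //.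
have T1 : (0 < T n)%N by have := total_ge n; lia.
have -> : p n.+1 1 1 = m%:R / (T n)%:R.
  rewrite /p /p_coef; case: smp; last first.
    by rewrite /= mul1r ffactn1 expr1.
  have -> : minn 1 m = 1%N by lia.
  by rewrite big_nat1 /= !bin1 /T /=; ring.
rewrite !bin1 mulrA ler_peMl ?invr_ge0 // expr1.
by rewrite -!natrM ler1n !muln_gt0; lia.
Qed.

(** The off-diagonal coefficient is at most, and the gap between the two diagonal
    ones at least, of order [1 / T]; comparing them directly makes the sum in
    [sum_jump_bound] telescope, without any asymptotics. *)
Lemma f_coef_gap_bound s r : (r < s)%N ->
  forall n, (0 < n)%N -> `|f n s r| <= f_bound s r * (f n s s - f n r r).
Proof.
move=> rs [//|n] _; apply: le_trans (f_coef_bound n rs) _.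
apply: ler_wpM2l (f_diag_diff n rs).
exact: f_bound_ge0.
Qed.
End Bounds.

(** * Sums over compositions and over decreasing index tuples *)

Lemma big_tuple_cons (R : nmodType) (T : finType) n (P : pred (seq T))
    (F : seq T -> R) :
  \sum_(t : n.+1.-tuple T | P t) F t =
  \sum_(x : T) \sum_(t : n.-tuple T | P (x :: t)) F (x :: t).
Proof.
rewrite pair_big_dep /=.
rewrite (reindex (fun u : T * n.-tuple T => [tuple of u.1 :: u.2])) //=.
exists (fun t : n.+1.-tuple T => (thead t, [tuple of behead t])) => [[x t] _|t _].
  by congr (_, _); apply: val_inj.
by rewrite [in RHS](tuple_eta t); apply: val_inj.
Qed.

Lemma big_tuple0 (R : nmodType) (T : finType) (P : pred (seq T))
    (F : seq T -> R) :
  \sum_(t : 0.-tuple T | P t) F t = if P [::] then F [::] else 0.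
Proof.
rewrite big_mkcond (bigD1 [tuple]) //= big1 ?addr0 // => t.
by move/eqP; case; exact: tuple0.
Qed.

Lemma is_decreasing_cons x i :
  is_decreasing (x :: i) = [&& (0 < x)%N, is_decreasing i & all (leq^~ x.-1) i].
Proof.
have tr : transitive (fun a b => b < a)%N by move=> ? ? ? /=; lia.
rewrite /is_decreasing /= (path_sortedE tr) -!andbA; case: x => //= x.
by case: (all _ _) => //=; rewrite andbC.
Qed.

Lemma is_composition_cons t x h :
  is_composition t (x :: h) = [&& (0 < x)%N, (x <= t)%N & is_composition (t - x) h].
Proof.
rewrite /is_composition /= -!andbA; case: (0 < x)%N => //=.
by case: (leqP x t) => xt; case: (all _ _) => //=; apply/idP/idP; lia.
Qed.

(** The compositions of [t] with fewer than [M] parts, hence all of them as soon as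
    [t < M]; the recursion is on the first part. *)
Fixpoint compositions (M t : nat) : seq (seq nat) :=
  if M is M'.+1 then
    if t is 0 then [:: [::]] else
    [seq x :: h | x <- iota 1 t, h <- compositions M' (t - x)]
  else [::].

Arguments compositions : simpl never.

Lemma compositions0 M : compositions M.+1 0 = [:: [::]].
Proof. by []. Qed.

Lemma compositionsS M t : compositions M.+1 t.+1 =
  flatten [seq [seq x :: h | h <- compositions M (t.+1 - x)] | x <- iota 1 t.+1].
Proof. by []. Qed.

Lemma compositions_fuel M M' t : (t < M)%N -> (t < M')%N ->
  compositions M t = compositions M' t.
Proof.
elim: M M' t => [//|M IH] [//|M'] [//|t] tM tM'.
rewrite !compositionsS; congr flatten; apply/eq_in_map => x; rewrite mem_iota => xt.
by congr map; apply: IH; lia.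
Qed.

Section Sums.
Variable R : realType.

Lemma big_compositionsS (F : seq nat -> R) M t :
  \sum_(h <- compositions M.+1 t.+1) F h =
  \sum_(1 <= x < t.+2) \sum_(h <- compositions M (t.+1 - x)) F (x :: h).
Proof. by rewrite big_allpairs_dep /index_iota subSS subn0. Qed.

(** Replaces the tuples of bounded parts by a list that satisfies a recursion on
    the first part, the recursion needed for [psi_recr]. *)
Lemma big_compositions (F : seq nat -> R) N M t : (t < N)%N ->
  \sum_(l < M)
    \sum_(h : l.-tuple 'I_N | is_composition t (map val h)) F (map val h) =
  \sum_(h <- compositions M t) F h.
Proof.
elim: M t F => [|M IH] t F tN; first by rewrite big_ord0 big_nil.
rewrite big_ord_recl (big_tuple0 (fun h => is_composition t (map val h))
  (fun h => F (map val h))) /=.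
under eq_bigr => l _ do rewrite /bump leq0n add1n (@big_tuple_cons _ _ _
  (fun h => is_composition t (map val h)) (fun h => F (map val h))).
rewrite exchange_big /=.
case: t tN => [|t] tN.
  rewrite {1}/is_composition /= compositions0 big_seq1 big1 ?addr0 // => x _; apply: big1 => l _.
  by apply: big_pred0 => h; rewrite is_composition_cons leqn0; lia.
rewrite {1}/is_composition /= add0r big_compositionsS.
rewrite [RHS]big_nat_cond.
rewrite (big_nat_widenl _ 0) // (big_nat_widen _ _ N) ?big_mkord; last by lia.
rewrite [RHS]big_mkcond; apply: eq_bigr => x _.
case: ifP => hx; last first.
  apply: big1 => l _; apply: big_pred0 => h; rewrite is_composition_cons.
  by apply/negbTE/negP; move: hx; lia.
rewrite -IH; last by lia.
apply: eq_bigr => l _; apply: eq_bigl => h; rewrite is_composition_cons.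
have -> : (0 < x)%N by lia.
by have -> : (x <= t.+1)%N by lia.
Qed.

Lemma big_compositions_tuple (F : seq nat -> R) t : (0 < t)%N ->
  \sum_(h <- compositions t.+1 t) F h =
  \sum_(1 <= l < t.+1)
    \sum_(h : l.-tuple 'I_t.+1 | is_composition t (map val h)) F (map val h).
Proof.
move=> t0; rewrite -(@big_compositions _ t.+1) // big_ord_recl /=.
rewrite big_pred0 ?add0r; last first.
  by move=> h; rewrite (tuple0 h) /is_composition /=; lia.
by rewrite big_add1 big_mkord.
Qed.

Section Weights.
Variable B : nat -> nat -> nat -> R.

(** A composition [h] of [s - k] and a decreasing tuple [i] describe a chain
    [s > s - h_1 > ... > k] whose [g]-th step is taken at time [i_g]; a step from
    [r] to [r'] at time [y] is weighted by [B r r' y]. *)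
Fixpoint chain_weight (s : nat) (h i : seq nat) : R :=
  match h, i with
  | x :: h', y :: i' => B s (s - x) y * chain_weight (s - x) h' i'
  | _, _ => 1
  end.

(** The total weight of the chains with jumps [h] and all times at most [n]:
    after a first step at time [y] the remaining ones happen before [y]. *)
Fixpoint chain_sum (n s : nat) (h : seq nat) : R :=
  if h is x :: h' then
    \sum_(1 <= y < n.+1) B s (s - x) y * chain_sum y.-1 (s - x) h'
  else 1.

Lemma sum_chain_weight_le N n s h l : (n < N)%N -> size h = l ->
  \sum_(i : l.-tuple 'I_N | is_decreasing (map val i) && all (leq^~ n) (map val i))
    chain_weight s h (map val i) = chain_sum n s h.
Proof.
elim: h n s l => [|x h IH] n s l nN <-.
  by rewrite (big_tuple0
    (fun i => is_decreasing (map val i) && all (leq^~ n) (map val i))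
    (fun i => chain_weight s [::] (map val i))).
rewrite (@big_tuple_cons _ _ _
  (fun i => is_decreasing (map val i) && all (leq^~ n) (map val i))
  (fun i => chain_weight s (x :: h) (map val i))) /=.
rewrite (big_nat_widenl _ 0) // (big_nat_widen _ _ N) ?big_mkord; last by lia.
rewrite [RHS]big_mkcond; apply: eq_bigr => y _.
case: ifP => hy; last first.
  apply: big_pred0 => i; rewrite is_decreasing_cons; apply/negbTE.
  by apply: contraFN hy => /andP[/and3P[y0 _ _] /andP[yn _]]; rewrite /= y0.
rewrite -(IH y.-1 _ (size h)) //; last by lia.
rewrite mulr_sumr; apply: eq_bigl => i; rewrite is_decreasing_cons.
have -> : (0 < y)%N by lia.
have -> : (y <= n)%N by lia.
case: (is_decreasing _) => //=; case: (boolP (all _ _)) => //= /allP H.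
by apply/allP => z /H; lia.
Qed.

Lemma all_ord_le N (i : seq 'I_N.+1) : all (leq^~ N) (map val i).
Proof. by apply/allP => z /mapP[y _ ->]; rewrite -ltnS /=. Qed.

Lemma sum_chain_weight n s h l : size h = l ->
  \sum_(i : l.-tuple 'I_n.+1 | is_decreasing (map val i))
    chain_weight s h (map val i) = chain_sum n s h.
Proof.
move=> hl; rewrite -(@sum_chain_weight_le n.+1 n s h l) //.
by apply: eq_bigl => i; rewrite all_ord_le andbT.
Qed.

End Weights.

Lemma chain_weight_norm B s h i :
  `|chain_weight B s h i| = chain_weight (fun a b n => `|B a b n|) s h i.
Proof.
by elim: h s i => [|x h IH] s [|y i] /=; rewrite ?normr1 // normrM IH.
Qed.

(** Dropping the constraint that the times decrease bounds the sum by a product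
    of one-step sums. *)
Lemma chain_sum_bound (B : nat -> nat -> nat -> R) (K : nat -> nat -> R) :
  (forall s r n, 0 <= B s r n) -> (forall s r, 0 <= K s r) ->
  (forall s r n, (r < s)%N -> \sum_(1 <= y < n.+1) B s r y <= K s r) ->
  forall t s h, is_composition t h -> (t <= s)%N ->
  exists2 M, 0 <= M & forall n, 0 <= chain_sum B n s h <= M.
Proof.
move=> B0 K0 BK t s h; elim: h t s => [|x h IH] t s.
  by move=> _ _; exists 1 => //= n; rewrite ler01 lexx.
rewrite is_composition_cons => /and3P[x0 xt ht] ts.
have [|M M0 HM] := IH (t - x)%N (s - x)%N ht; first by lia.
exists (K s (s - x)%N * M); first by rewrite mulr_ge0.
move=> n /=; apply/andP; split.
  by apply: sumr_ge0 => y _; rewrite mulr_ge0 //; case/andP: (HM y.-1).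
apply: (@le_trans _ _ (\sum_(1 <= y < n.+1) B s (s - x)%N y * M)).
  by apply: ler_sum => y _; rewrite ler_wpM2l //; case/andP: (HM y.-1).
by rewrite -mulr_suml ler_wpM2r // BK //; lia.
Qed.
End Sums.

(** * The coefficients phi: normalisation, recursion, summable jumps *)

Section Phi.
Variables (R : realType) (smp : sampling_model) (m c sigma T0 : nat).
Hypotheses (hm : (1 <= m)%N) (hc : (0 < c)%N) (hs : (0 < sigma)%N).
Hypothesis hT : (m <= T0)%N.

Let f := f_coef R smp m c sigma T0.
Let ph := phi R smp m c sigma T0.

Definition diag_prod (r n : nat) : R :=
  \prod_(1 <= j < n.+1) f_coef R smp m c sigma T0 j r r.

Local Notation D := diag_prod.

Lemma diag_prod0 r : D r 0 = 1.
Proof. by rewrite /diag_prod big_geq. Qed.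

Lemma diag_prodS r n : D r n.+1 = D r n * f n.+1 r r.
Proof. by rewrite /diag_prod big_nat_recr. Qed.

Lemma diag_prod_gt0 r n : 0 < D r n.
Proof.
elim: n => [|n IH]; first by rewrite diag_prod0.
by rewrite diag_prodS mulr_gt0 // (lt_le_trans ltr01) // f_diag_ge1.
Qed.

Lemma diag_prod_neq0 r n : D r n != 0.
Proof. by rewrite gt_eqF // diag_prod_gt0. Qed.

Lemma diag_prod_split r i n : (i <= n)%N ->
  \prod_(i.+1 <= j < n.+1) f j r r = D r n / D r i.
Proof.
move=> ni; rewrite /diag_prod [X in _ = X / _](big_cat_nat (n := i.+1)) //=.
by rewrite mulrAC divff ?mul1r // -/(D r i) diag_prod_neq0.
Qed.

(** Variation of constants: dividing the [s]-th moment by [diag_prod s] turns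
    the recursion for the moments into one without diagonal part, and [jump]
    is its off-diagonal coefficient. *)
Definition jump (s r i : nat) : R :=
  f_coef R smp m c sigma T0 i s r * D r i.-1 / D s i.

Lemma psum0 h : psum h 0 = 0%N. Proof. by rewrite /psum take0. Qed.
Lemma psum_cons x h q : psum (x :: h) q.+1 = (x + psum h q)%N. Proof. by []. Qed.

Lemma phi_factor_cons s x h y i n g : (0 < y)%N ->
  phi_factor R smp m c sigma T0 s (x :: h) (y :: i) n g.+2 =
  phi_factor R smp m c sigma T0 (s - x) h i y.-1 g.+1.
Proof. by case: y => // y _; rewrite /phi_factor /= !psum_cons !subnDA. Qed.

Lemma phi_factor_tail s x h y i n k : (0 < y)%N ->
  \prod_(2 <= g < k.+2) phi_factor R smp m c sigma T0 s (x :: h) (y :: i) n g =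
  \prod_(1 <= g < k.+1) phi_factor R smp m c sigma T0 (s - x) h i y.-1 g.
Proof.
move=> y0; rewrite big_add1 /= big_nat_cond [RHS]big_nat_cond; apply: eq_bigr.
by move=> [|g] // _; rewrite phi_factor_cons.
Qed.

(** The blocks [\prod_(i_g < j < i_{g-1}) f_{j,r,r}] are quotients of two values of
    [diag_prod r], so the product factors into one [jump] per time [i_g]. *)
Lemma prod_phi_factor s h i n : size h = size i -> is_decreasing i ->
  (head 0%N i <= n)%N ->
  \prod_(1 <= g < (size i).+2) phi_factor R smp m c sigma T0 s h i n g =
  D s n * chain_weight jump s h i.
Proof.
elim: h s i n => [|x h IH] s [|y i] n //=.
  by rewrite big_nat1 /phi_factor /index_at /= psum0 subn0 mul1r mulr1.
move=> [hi]; rewrite is_decreasing_cons => /and3P[y0 di ai] yn.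
rewrite big_ltn // phi_factor_tail // IH //; last first.
  by case: i ai {hi di} => //= z i /andP[].
rewrite /phi_factor /index_at /= psum0 subn0 /psum /= take0 /= addn0.
by rewrite diag_prod_split // /jump; field; rewrite diag_prod_neq0.
Qed.

Lemma phi_lim_term_weight s h i : size h = size i -> (0 < size i)%N ->
  is_decreasing i ->
  phi_lim_term R smp m c sigma T0 s h i = chain_weight jump s h i.
Proof.
case: h i => [|x h] [|y i] //= [hi] _.
rewrite is_decreasing_cons => /and3P[y0 di ai].
rewrite /phi_lim_term /= phi_factor_tail // prod_phi_factor //; last first.
  by case: i ai {hi di} => //= z i /andP[].
rewrite /index_at /= /psum /= take0 /= addn0 /jump -/(D s y); field.
by rewrite diag_prod_neq0.
Qed.

(** [phi n s k] divided by [phi n s s]. *)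
Definition psi (n s k : nat) : R :=
  \sum_(h <- compositions (s - k).+1 (s - k)) chain_sum jump n s h.

Lemma phi_psi n s k : (k <= s)%N -> ph n s k = D s n * psi n s k.
Proof.
move=> ks; rewrite /ph /phi /psi; case: eqP => [->|/eqP ks'].
  by rewrite subnn compositions0 big_seq1 mulr1.
rewrite big_compositions_tuple; last by lia.
rewrite mulr_sumr; apply: eq_bigr => l _.
rewrite mulr_sumr; apply: eq_bigr => h _.
rewrite -(@sum_chain_weight _ _ n s _ l) ?size_map ?size_tuple // mulr_sumr.
apply: eq_bigr => i di.
rewrite -prod_phi_factor ?size_map ?size_tuple //.
by case: (map val i) (all_ord_le i) => //= z ? /andP[].
Qed.

(** A chain with times at most [n + 1] either has no step at time [n + 1], or its
    first step [s > r] is taken then. *)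
Lemma psi_recr n s k : (k <= s)%N ->
  psi n.+1 s k = psi n s k + \sum_(k <= r < s) jump s r n.+1 * psi n r k.
Proof.
rewrite leq_eqVlt => /predU1P[->|ks].
  by rewrite /psi subnn big_geq // addr0 compositions0 !big_seq1.
have [t Et] : exists t, (s - k)%N = t.+1 by exists (s - k).-1; lia.
rewrite /psi Et 2!big_compositionsS.
rewrite (big_addn 0 _ k) Et big_mkord.
rewrite (big_add1 _ _ 0) [X in _ = X + _]big_add1 /= !big_mkord.
rewrite [X in _ = _ + X](reindex_inj rev_ord_inj) /= -big_split /=.
apply: eq_bigr => x _.
have xt := ltn_ord x.
have -> : (t.+1 - x.+1 + k = s - x.+1)%N by lia.
have -> : (s - x.+1 - k = t.+1 - x.+1)%N by lia.
rewrite (@compositions_fuel (t.+1 - x.+1).+1 t.+1) //; try lia.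
rewrite mulr_sumr -big_split /=.
by apply: eq_bigr => h _; rewrite big_nat_recr.
Qed.

Lemma psi0 s k : (k <= s)%N -> psi 0 s k = (k == s)%:R.
Proof.
rewrite leq_eqVlt => /predU1P[->|ks].
  by rewrite /psi subnn eqxx compositions0 big_seq1.
have [t Et] : exists t, (s - k)%N = t.+1 by exists (s - k).-1; lia.
rewrite ltn_eqF // /psi Et big_compositionsS big1 // => x _.
by apply: big1 => h _ /=; rewrite big_geq.
Qed.

Lemma phi0 s k : (k <= s)%N -> ph 0 s k = (k == s)%:R.
Proof. by move=> ks; rewrite phi_psi // diag_prod0 mul1r psi0. Qed.

Lemma phi_recr n s k : (k <= s)%N ->
  ph n.+1 s k = \sum_(k <= r < s.+1) f n.+1 s r * ph n r k.
Proof.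
move=> ks; rewrite big_nat_recr // !phi_psi // psi_recr // mulrDr [RHS]addrC.
congr (_ + _); first by rewrite diag_prodS; ring.
transitivity (\sum_(k <= r < s) f n.+1 s r * ph n r k); last by [].
rewrite mulr_sumr big_nat_cond [RHS]big_nat_cond; apply: eq_bigr.
move=> r /andP[/andP[kr rs] _]; rewrite phi_psi // /jump -[n.+1.-1]/n -/f.
by field; rewrite diag_prod_neq0.
Qed.

(** With [rho = diag_prod r / diag_prod s], the gap of the diagonal coefficients
    is what makes [rho] decrease, hence [|jump s r y|] is at most a constant times
    [rho (y - 1) - rho y], and this telescopes. *)
Lemma sum_jump_bound s r n : (r < s)%N ->
  \sum_(1 <= y < n.+1) `|jump s r y| <= f_bound R m c s r.
Proof.
move=> rs; pose rho i := D r i / D s i.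
have fb := f_bound_ge0 R m c s r.
have rho0 i : 0 <= rho i by rewrite divr_ge0 // ltW ?diag_prod_gt0.
suff H :
  \sum_(1 <= y < n.+1) `|jump s r y| <= f_bound R m c s r * (1 - rho n).
  apply: le_trans H _; rewrite -[leRHS]mulr1 ler_wpM2l //.
  by rewrite gerBl.
elim: n => [|n IH].
  by rewrite big_geq // /rho !diag_prod0 divr1 subrr mulr0.
rewrite big_nat_recr //.
apply: (@le_trans _ _ (f_bound R m c s r * (1 - rho n) +
  f_bound R m c s r * (rho n - rho n.+1))); last first.
  by rewrite -mulrDr ler_wpM2l // addrA subrK.
apply: lerD => //; rewrite /jump -[n.+1.-1]/n normrM normfV normrM.
rewrite (gtr0_norm (diag_prod_gt0 s _)) (gtr0_norm (diag_prod_gt0 r _)).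
have -> : f_bound R m c s r * (rho n - rho n.+1) =
   f_bound R m c s r * (f n.+1 s s - f n.+1 r r) * (D r n / D s n.+1).
  have : f n.+1 s s != 0 by rewrite gt_eqF // (lt_le_trans ltr01) // f_diag_ge1.
  rewrite /rho !diag_prodS => fn; field.
  by rewrite fn diag_prod_neq0.
rewrite -mulrA ler_wpM2r //; first by rewrite divr_ge0 // ltW ?diag_prod_gt0.
exact: f_coef_gap_bound.
Qed.

End Phi.

Lemma big_tuple_rcons (R : nmodType) (T : finType) n (F : seq T -> R) :
  \sum_(t : n.+1.-tuple T) F t =
  \sum_(t : n.-tuple T) \sum_(x : T) F (rcons t x).
Proof.
elim: n F => [|n IH] F.
  rewrite (big_tuple0 xpredT (fun t => \sum_(x : T) F (rcons t x))) /=.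
  rewrite (@big_tuple_cons _ _ _ xpredT F); apply: eq_bigr => x _.
  by rewrite (big_tuple0 xpredT (fun t => F (x :: t))).
rewrite (@big_tuple_cons _ _ _ xpredT F).
rewrite (@big_tuple_cons _ _ _ xpredT (fun t => \sum_(x : T) F (rcons t x))).
by apply: eq_bigr => x _; rewrite (IH (fun t => F (x :: t))).
Qed.

(** * Moments of the urn process by conditioning on the history *)

Section Urn.
Variables (m c sigma W0 B0 : nat).
Lemma eq_urn x y n : (forall i, (0 < i <= n)%N -> x i = y i) ->
  urn m c sigma W0 B0 x n = urn m c sigma W0 B0 y n.
Proof.
elim: n => //= n IH H; rewrite IH; last by move=> i hi; apply: H; lia.
by rewrite H //; lia.
Qed.

Hypothesis hsigma : (m * c <= sigma)%N.

Lemma urn_total x n : (forall i, (0 < i <= n)%N -> (x i <= m)%N) ->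
  ((urn m c sigma W0 B0 x n).1 + (urn m c sigma W0 B0 x n).2)%N =
  total sigma (W0 + B0) n.
Proof.
rewrite /total; elim: n => [|n IH] H /=; first by lia.
have := IH (fun i hi => H i ltac:(lia)).
have xm : (x n.+1 <= m)%N by apply: H; lia.
rewrite /added_white /added_black subKn //.
have : (x n.+1 * c <= sigma)%N by apply: leq_trans hsigma; rewrite leq_mul2r xm orbT.
by lia.
Qed.
End Urn.

Section Proba.
Variables (R : realType) (smp : sampling_model) (m c sigma W0 B0 : nat).
Hypothesis hsigma : (m * c <= sigma)%N.
Variables (d : measure_display) (Omega : measurableType d)
    (P : probability Omega R) (K : nat -> {RV P >-> nat}).
Hypothesis hK : urn_draws smp m c sigma W0 B0 K.

Let T n := total sigma (W0 + B0) n.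

Lemma expectation_finite_sum (I : finType) (A : I -> set Omega) (a : I -> R) :
  (forall i, measurable (A i)) -> (forall i, 0 <= a i) ->
  'E_P[fun w => (\sum_i a i * \1_(A i) w)%R]%E =
  (\sum_i a i * fine (P (A i)))%:E.
Proof.
move=> mA a0; rewrite unlock.
under eq_integral => w _ do rewrite -sumEFin.
rewrite ge0_integral_sum //; last 2 first.
- move=> i; apply/measurable_EFinP.
  by apply: measurable_funM => //; exact: measurable_indic.
- by move=> i w _; rewrite lee_fin mulr_ge0 // indicE.
rewrite -sumEFin; apply: eq_bigr => i _.
under eq_integral => w _ do rewrite EFinM.
rewrite ge0_integralZl_EFin //; last first.
  by apply/measurable_EFinP; exact: measurable_indic.
by rewrite integral_indic // setIT EFinM fineK // fin_num_measure.
Qed.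

(** Draws are numbered from 1, so a history [t] is shifted by a dummy entry. *)
Definition past (t : seq nat) (i : nat) : nat := nth 0%N (0%N :: t) i.

Definition history (t : seq nat) : set Omega :=
  [set omega | forall i, (0 < i < (size t).+1)%N -> K i omega = past t i].

Lemma past_rcons t k i : (i <= size t)%N -> past (rcons t k) i = past t i.
Proof. by move=> it; rewrite /past -rcons_cons nth_rcons /= ltnS it. Qed.

Lemma past_last t k : past (rcons t k) (size t).+1 = k.
Proof. by rewrite /past -rcons_cons nth_rcons /= ltnn eqxx. Qed.

Lemma history_rcons t k :
  history (rcons t k) = history t `&` [set omega | K (size t).+1 omega = k].
Proof.
apply/seteqP; split => w; rewrite /history /= size_rcons.
  move=> H; split; last by rewrite H ?past_last //; lia.
  by move=> i hi; rewrite H ?past_rcons //; lia.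
move=> [H1 H2] i hi; have [->|ni] := eqVneq i (size t).+1.
  by rewrite past_last.
by rewrite H1 ?past_rcons //; lia.
Qed.

Lemma measurable_history t : measurable (history t).
Proof.
elim/last_ind: t => [|t k IH].
  rewrite (_ : history [::] = setT) //.
  by apply/seteqP; split => // w _ i /=; lia.
rewrite history_rcons; apply: measurableI => //.
rewrite -[X in measurable X]setTI.
exact: (measurable_funPT (K (size t).+1) measurableT [set k]).
Qed.

Definition prob_history (t : seq nat) : R := fine (P (history t)).

Lemma prob_history_rcons t k : (k <= m)%N ->
  prob_history (rcons t k) = prob_history t *
    sample_prob smp m R (urn m c sigma W0 B0 (past t) (size t)).1
     (urn m c sigma W0 B0 (past t) (size t)).2 k.
Proof.
move=> km; rewrite /prob_history history_rcons.
have [_ H] := hK; have /= := H (size t).+1 (past t) k isT km.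
rewrite -/(history t) => ->.
by rewrite fineM // fin_num_measure //; exact: measurable_history.
Qed.

Lemma past_samples n (t : n.-tuple 'I_m.+1) (j : 'I_n) :
  past (map val t) j.+1 = tnth t j.
Proof. by rewrite /past /= (nth_map ord0) ?size_tuple // -tnth_nth. Qed.

(** Samples have at most [m] white balls, so the events [history] of length [n]
    form a finite partition on whose parts the urn is constant. *)
Lemma expectation_history n (g : nat -> R) : (forall w, 0 <= g w) ->
  'E_P[fun omega => g (urn m c sigma W0 B0 (fun i => K i omega) n).1]%E =
  (\sum_(t : n.-tuple 'I_m.+1)
     g (urn m c sigma W0 B0 (past (map val t)) n).1 * prob_history (map val t))%:E.
Proof.
move=> g0; rewrite -expectation_finite_sum //; last first.
  by move=> t; exact: measurable_history.
congr expectation; apply/funext => w.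
have [Km _] := hK.
pose t0 : n.-tuple 'I_m.+1 := [tuple inord (K i.+1 w) | i < n].
have t0K i : (0 < i < n.+1)%N -> past (map val t0) i = K i w.
  case: i => // j hj.
  rewrite (past_samples t0 (Ordinal (hj : (j < n)%N))) tnth_mktuple /=.
  by rewrite inordK // ltnS Km.
have h0 : history (map val t0) w.
  by move=> i; rewrite size_map size_tuple => hi; rewrite t0K.
rewrite (bigD1 t0) //= big1 ?addr0.
  rewrite indicE mem_set // mulr1; congr (g _.1).
  by apply: eq_urn => i hi; rewrite t0K.
move=> t tt0; rewrite indicE memNset ?mulr0 // => ht.
move/eqP: tt0; apply; apply: eq_from_tnth => i; apply: val_inj.
have := ht i.+1; rewrite size_map size_tuple => /(_ (ltn_ord i)).
rewrite -t0K; last exact: ltn_ord.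
by rewrite !past_samples => E; exact/esym.
Qed.

(** The mean of [g] of the number of white balls after [n] draws, the last draw
    being integrated out first; the number of black balls is [T n' - w]. *)
Fixpoint white_mean (n : nat) (g : nat -> R) : R :=
  if n is n'.+1 then
    white_mean n' (fun w => \sum_(k < m.+1)
      sample_prob smp m R w (T n' - w) k * g (w + k * c)%N)
  else g W0.

Lemma past_samples_le n (t : n.-tuple 'I_m.+1) i : (past (map val t) i <= m)%N.
Proof.
rewrite /past; case: i => // i /=.
have [it|it] := ltnP i (size (map val t)); last by rewrite nth_default.
by rewrite (nth_map ord0) -?(size_map val) // -ltnS ltn_ord.
Qed.

Lemma sum_history n (g : nat -> R) :
  \sum_(t : n.-tuple 'I_m.+1)
     g (urn m c sigma W0 B0 (past (map val t)) n).1 * prob_history (map val t) =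
  white_mean n g.
Proof.
elim: n g => [|n IH] g.
  rewrite (big_tuple0 xpredT (fun t : seq 'I_m.+1 =>
    g (urn m c sigma W0 B0 (past (map val t)) 0).1 *
    prob_history (map val t))) /=.
  rewrite /prob_history (_ : history _ = setT) ?probability_setT ?mulr1 //.
  by apply/seteqP; split => // w _ i /=; lia.
rewrite /= -IH.
rewrite (@big_tuple_rcons _ _ _ (fun t : seq 'I_m.+1 =>
  g (urn m c sigma W0 B0 (past (map val t)) n.+1).1 *
  prob_history (map val t))).
apply: eq_bigr => t _; rewrite mulr_suml; apply: eq_bigr => k _.
rewrite map_rcons prob_history_rcons; last by rewrite -ltnS ltn_ord.
rewrite size_map size_tuple.
have E : urn m c sigma W0 B0 (past (rcons (map val t) (val k))) n =
         urn m c sigma W0 B0 (past (map val t)) n.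
  by apply: eq_urn => i hi; rewrite past_rcons // size_map size_tuple; lia.
rewrite [urn _ _ _ _ _ _ n.+1]/= E.
have -> : past (rcons (map val t) (val k)) n.+1 = k.
  by rewrite -{2}(size_tuple t) -(size_map val) past_last.
rewrite /added_white /= subKn; last by rewrite -ltnS ltn_ord.
rewrite /T -(@urn_total m c sigma W0 B0 hsigma (past (map val t))); last first.
  by move=> i _; exact: past_samples_le.
by rewrite addKn; ring.
Qed.

Lemma expectation_white n (g : nat -> R) : (forall w, 0 <= g w) ->
  'E_P[fun omega => g (urn m c sigma W0 B0 (fun i => K i omega) n).1]%E =
  (white_mean n g)%:E.
Proof. by move=> g0; rewrite expectation_history // sum_history. Qed.

(** Only reachable contents matter: the number of white balls never exceeds the
    total. *)
Lemma eq_white_mean n (g h : nat -> R) : (forall w, (w <= T n)%N -> g w = h w) ->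
  white_mean n g = white_mean n h.
Proof.
elim: n g h => [|n IH] g h gh /=; first by rewrite gh // /T /total; lia.
apply: IH => w wT; apply: eq_bigr => k _; rewrite gh //.
have : (k * c <= sigma)%N.
  by apply: leq_trans hsigma; rewrite leq_mul2r -ltnS ltn_ord orbT.
by move: wT; rewrite /T /total; lia.
Qed.

Lemma white_mean_sum n (I : Type) (r : seq I) (a : I -> R) (h : I -> nat -> R) :
  white_mean n (fun w => \sum_(i <- r) a i * h i w) =
  \sum_(i <- r) a i * white_mean n (h i).
Proof.
elim: n h => [//|n IH] h /=; rewrite -IH; apply: eq_white_mean => w _.
under eq_bigr => k _ do rewrite mulr_sumr.
rewrite exchange_big /=; apply: eq_bigr => i _.
by rewrite mulr_sumr; apply: eq_bigr => k _; ring.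
Qed.

Hypotheses (hm : (1 <= m)%N) (hc : (0 < c)%N) (hT0 : (m <= W0 + B0)%N).

(** [sum_sample_step] integrates out the last draw; [phi_recr] is the resulting
    recursion. *)
Lemma white_mean_expr n s : (0 < s)%N ->
  white_mean n (fun w => w%:R ^+ s) =
  \sum_(1 <= k < s.+1) phi R smp m c sigma (W0 + B0) n s k * W0%:R ^+ k.
Proof.
have sg0 : (0 < sigma)%N by move: hsigma; rewrite leqNgt; nia.
elim: n s => [|n IH] s s0.
  rewrite /= big_nat_recr //= phi0 // eqxx mul1r.
  rewrite big_nat_cond big1 ?add0r // => k hk.
  by rewrite phi0 ?ltn_eqF ?mul0r //; lia.
transitivity (white_mean n (fun w => \sum_(1 <= r < s.+1)
  f_coef R smp m c sigma (W0 + B0) n.+1 s r * w%:R ^+ r)).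
  rewrite [white_mean n.+1 _]/=; apply: eq_white_mean => w wT.
  rewrite -(@sum_sample_step _ _ _ _ _ _ hm s n.+1 w (T n - w)) //.
  - by rewrite subnKC //; apply: leq_trans hT0 _; rewrite /T /total; lia.
  - by rewrite subnKC.
rewrite white_mean_sum.
under eq_big_nat => r hr.
  rewrite IH; last by case/andP: hr.
  rewrite mulr_sumr (big_nat_widen _ _ s.+1); last by lia.
  over.
rewrite (exchange_big_dep_nat xpredT) //.
rewrite big_nat_cond [RHS]big_nat_cond; apply: eq_bigr => k /andP[/andP[k1 k2] _].
rewrite phi_recr // mulr_suml [RHS](big_nat_widenl _ 1) //.
transitivity (\sum_(1 <= r < s.+1 | (k < r.+1)%N)
  f_coef R smp m c sigma (W0 + B0) n.+1 s r *
  (phi R smp m c sigma (W0 + B0) n r k * W0%:R ^+ k)).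
  by [].
rewrite [LHS]big_nat_cond [RHS]big_nat_cond.
by apply: eq_big => [r|r _]; [rewrite ltnS | rewrite mulrA].
Qed.
End Proba.

(** * Absolutely convergent sums over decreasing index tuples *)

Section Exhaustion.
Variables (R : realType) (I : choiceType) (D : set I) (r : nat -> seq I).
Hypothesis uniq_r : forall n, uniq (r n).
Hypothesis r_sub : forall n, [set` r n] `<=` D.
Hypothesis r_exhaust : forall X : seq I, [set` X] `<=` D ->
  exists n, {subset X <= r n}.
Hypothesis r_mono : forall n p, (n <= p)%N -> {subset r n <= r p}.

(** Every finite subset of [D] lies in some [r n], so the supremum defining the
    unordered sum is the limit of the increasing sums over [r n]. *)
Lemma cvg_esum_exhaustion (w : I -> R) : (forall i, 0 <= w i) ->
  (\sum_(i <- r n) w i)%:E @[n --> \oo] --> (\esum_(i in D) (w i)%:E)%E.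
Proof.
move=> w0.
have fsE n : (\sum_(i <- r n) w i)%:E = (\sum_(i \in [set` r n]) (w i)%:E)%R.
  by rewrite -fsbig_seq // sumEFin.
have -> : (\esum_(i in D) (w i)%:E)%E =
    ereal_sup (range (fun n => (\sum_(i <- r n) w i)%:E)).
  apply/eqP; rewrite eq_le; apply/andP; split; last first.
    apply: ge_ereal_sup => _ [n _ <-]; apply: esum_ge.
    exists [set` r n]; last by rewrite -fsE.
    by split; [exact: finite_seq | exact: r_sub].
  apply: ge_ereal_sup => _ [X [finX XD] <-].
  have /finite_seqP[s sX] := finX.
  have [n sn] := r_exhaust (X := s) ltac:(by rewrite -sX).
  apply: (@le_trans _ _ (\sum_(i <- r n) w i)%:E); last first.
    by apply: ereal_sup_ubound; exists n.
  rewrite fsE; apply: lee_fsum_nneg_subset => //.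
  - by move=> i; rewrite !inE /= sX => /sn.
  - by move=> i _; rewrite lee_fin.
apply: ereal_nondecreasing_cvgn => n p np.
rewrite !fsE; apply: lee_fsum_nneg_subset; try exact: finite_seq.
- by move=> i; rewrite !inE /=; exact: r_mono.
- by move=> i _; rewrite lee_fin.
Qed.

Lemma summable_exhaustion (u : I -> R) (M : R) :
  (forall n, \sum_(i <- r n) `|u i| <= M) -> summable D (EFin \o u).
Proof.
move=> uM; rewrite /summable.
have /cvg_lim <- // := cvg_esum_exhaustion (w := fun i => `|u i|) (fun i => normr_ge0 _).
apply: (@le_lt_trans _ _ M%:E); last by rewrite ltry.
apply: lime_le; last by near=> n; rewrite lee_fin.
by apply/cvg_ex; eexists; exact: cvg_esum_exhaustion.
Unshelve. all: by end_near. Qed.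

(** Split [u] into its positive and negative parts, both dominated by [`|u|]. *)
Lemma cvg_unordered_sum (u : I -> R) (M : R) :
  (forall n, \sum_(i <- r n) `|u i| <= M) ->
  \sum_(i <- r n) u i @[n --> \oo] --> unordered_sum D u.
Proof.
move=> uM; rewrite /unordered_sum.
have main (w : I -> R) : (forall i, 0 <= w i <= `|u i|) -> exists e : R,
   (\esum_(i in D) (w i)%:E)%E = e%:E /\ \sum_(i <- r n) w i @[n --> \oo] --> e.
  move=> wu; have w0 i : 0 <= w i by case/andP: (wu i).
  have fin : (\esum_(i in D) (w i)%:E)%E \is a fin_num.
    rewrite ge0_fin_numE; last by apply: esum_ge0 => i _; rewrite lee_fin.
    apply: le_lt_trans (summable_exhaustion uM).
    by apply: le_esum => i _; rewrite /= lee_fin; case/andP: (wu i).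
  exists (fine (\esum_(i in D) (w i)%:E)%E); rewrite fineK //; split => //.
  have := cvg_esum_exhaustion w0; rewrite -[X in _ --> X]fineK //.
  by move/fine_cvgP => [].
have [|e1 [E1 c1]] := main (fun i => Num.max (u i) 0).
  by move=> i; rewrite le_max lexx orbT ge_max ler_norm normr_ge0.
have [|e2 [E2 c2]] := main (fun i => Num.max (- u i) 0).
  by move=> i; rewrite le_max lexx orbT ge_max -normrN ler_norm normr_ge0.
have -> : \esum_(i in D) ((EFin \o u)^\+ i)%E = e1%:E.
  by rewrite -E1; congr (esum D _); apply/funext => i; rewrite funeposE /= EFin_max.
have -> : \esum_(i in D) ((EFin \o u)^\- i)%E = e2%:E.
  by rewrite -E2; congr (esum D _); apply/funext => i; rewrite funenegE /= EFin_max.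
rewrite (_ : (fun n => \sum_(i <- r n) u i) =
  (fun n => \sum_(i <- r n) Num.max (u i) 0 -
            \sum_(i <- r n) Num.max (- u i) 0)).
  exact: cvgB.
apply/funext => n; rewrite -sumrB; apply: eq_bigr => i _.
by case: (leP (u i) 0); case: (leP (- u i) 0); lra.
Qed.
End Exhaustion.

Section DecreasingTuples.
Variables (R : realType) (l : nat).

Definition decreasing_le (n : nat) : seq (l.-tuple nat) :=
  [seq map_tuple val i | i <- enum {: l.-tuple 'I_n.+1}
                       & is_decreasing (map val (val i))].

Lemma big_decreasing_le (F : seq nat -> R) n :
  \sum_(i <- decreasing_le n) F i =
  \sum_(i : l.-tuple 'I_n.+1 | is_decreasing (map val i)) F (map val i).
Proof. by rewrite /decreasing_le big_map big_filter big_enum_cond. Qed.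

Lemma uniq_decreasing_le n : uniq (decreasing_le n).
Proof.
rewrite map_inj_uniq => [|i j /(congr1 val) /= E].
  by apply: filter_uniq; rewrite enumT -enumT enum_uniq.
by apply: val_inj; apply: (inj_map val_inj).
Qed.

Lemma mem_decreasing_le n (i : l.-tuple nat) :
  (i \in decreasing_le n) = is_decreasing i && all (leq^~ n) i.
Proof.
apply/mapP/andP => [[j]|[di ai]].
  by rewrite mem_filter => /andP[dj _] ->; split => //; exact: all_ord_le.
have E : map val (map_tuple (@inord n) i) = i.
  rewrite /= -map_comp -[RHS]map_id; apply/eq_in_map => x xi /=.
  by rewrite inordK // ltnS (allP ai).
exists (map_tuple (@inord n) i); last by apply: val_inj; exact/esym/E.
by rewrite mem_filter E di mem_enum.
Qed.

Lemma decreasing_le_exhaust (X : seq (l.-tuple nat)) :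
  [set` X] `<=` [set i | is_decreasing i] ->
  exists n, {subset X <= decreasing_le n}.
Proof.
elim: X => [|i X IH] XD; first by exists 0%N.
have [|n Xn] := IH; first by move=> j jX; apply: XD; rewrite /= inE jX orbT.
exists (maxn n (\max_(x <- i) x)) => j; rewrite inE mem_decreasing_le.
case/predU1P => [->|/Xn].
  apply/andP; split; first by apply: XD; rewrite /= inE eqxx.
  by apply/allP => x xi; rewrite leq_max (leq_bigmax_seq _ xi) ?orbT.
rewrite mem_decreasing_le => /andP[-> /allP aj] /=.
by apply/allP => x xj; rewrite leq_max aj.
Qed.

Lemma cvg_sum_decreasing (u : seq nat -> R) (M : R) :
  (forall n, \sum_(i : l.-tuple 'I_n.+1 | is_decreasing (map val i))
      `|u (map val i)| <= M) ->
  summable [set i : l.-tuple nat | is_decreasing i] (fun i => (u i)%:E) /\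
  \sum_(i : l.-tuple 'I_n.+1 | is_decreasing (map val i)) u (map val i)
    @[n --> \oo] --> unordered_sum [set i : l.-tuple nat | is_decreasing i]
      (fun i : l.-tuple nat => u i).
Proof.
move=> uM.
have rs n : [set` decreasing_le n] `<=` [set i : l.-tuple nat | is_decreasing i].
  by move=> i; rewrite /= mem_decreasing_le => /andP[].
have rm n p : (n <= p)%N -> {subset decreasing_le n <= decreasing_le p}.
  move=> np i; rewrite !mem_decreasing_le => /andP[-> /allP ai].
  by apply/allP => x /ai /= /leq_trans; apply.
have uM' n : \sum_(i <- decreasing_le n) `|u i| <= M.
  by rewrite (big_decreasing_le (fun i => `|u i|)).
split.
  exact: (summable_exhaustion uniq_decreasing_le rs decreasing_le_exhaust rm
            uM').
under eq_fun => n do rewrite -big_decreasing_le.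
exact: (cvg_unordered_sum uniq_decreasing_le rs decreasing_le_exhaust rm uM').
Qed.
End DecreasingTuples.

Local Notation Re := complex.Re.
Local Notation Im := complex.Im.
Local Notation normc := Normc.normc.

(** * Complex sequences of slow multiplicative variation *)

Section ComplexNorm.
Variable R : realType.
Implicit Types (z w : R[i]).

Lemma normc_ge0 z : 0 <= normc z.
Proof. by case: z => a b; exact: sqrtr_ge0. Qed.

Lemma normcD z w : normc (z + w) <= normc z + normc w.
Proof. exact: (@le_normcD R z w). Qed.

Lemma normcNE z : normc (- z) = normc z.
Proof. exact: (@normcN R z). Qed.

Lemma normc_real (x : R) : normc x%:C%C = `|x|.
Proof. by rewrite /= expr0n addr0 sqrtr_sqr. Qed.

Lemma normc_nat n : normc (n%:R : R[i]) = n%:R.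
Proof. by rewrite -(rmorph_nat (real_complex R)) normc_real normr_nat. Qed.

Lemma Re_le_normc z : `|Re z| <= normc z.
Proof.
case: z => a b /=; rewrite -sqrtr_sqr ler_sqrt ?lerDl ?sqr_ge0 //.
by rewrite addr_ge0 ?sqr_ge0.
Qed.

Lemma Im_le_normc z : `|Im z| <= normc z.
Proof.
case: z => a b /=; rewrite -sqrtr_sqr ler_sqrt ?lerDr ?sqr_ge0 //.
by rewrite addr_ge0 ?sqr_ge0.
Qed.

Lemma normc_le_ReIm z : normc z <= `|Re z| + `|Im z|.
Proof.
case: z => a b /=; rewrite -[leRHS]ger0_norm ?addr_ge0 // -sqrtr_sqr.
rewrite ler_sqrt ?sqr_ge0 // sqrrD !real_normK ?num_real //.
by rewrite -addrA lerD2l lerDr mulrn_wge0 ?mulr_ge0.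
Qed.

Lemma normc_sqr z : normc z ^+ 2 = Re z ^+ 2 + Im z ^+ 2.
Proof. by case: z => a b /=; rewrite sqr_sqrtr // addr_ge0 ?sqr_ge0. Qed.

Definition ccvg (u : nat -> R[i]) (l : R[i]) : Prop :=
  Re (u n) @[n --> \oo] --> Re l /\ Im (u n) @[n --> \oo] --> Im l.

Lemma ReM z w : Re (z * w) = Re z * Re w - Im z * Im w.
Proof. by case: z w => [a b] [a' b']. Qed.

Lemma ImM z w : Im (z * w) = Re z * Im w + Im z * Re w.
Proof. by case: z w => [a b] [a' b']. Qed.

Lemma ccvgM u v l l' : ccvg u l -> ccvg v l' -> ccvg (fun n => u n * v n) (l * l').
Proof.
move=> [u1 u2] [v1 v2]; split.
  under eq_fun => n do rewrite ReM.
  by rewrite ReM; apply: cvgB; exact: cvgM.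
under eq_fun => n do rewrite ImM.
by rewrite ImM; apply: cvgD; exact: cvgM.
Qed.

Lemma ccvg_cst l : ccvg (fun=> l) l.
Proof. by split; exact: cvg_cst. Qed.

Lemma ccvg_prod (I : eqType) (r : seq I) (u : I -> nat -> R[i]) (l : I -> R[i]) :
  (forall i, i \in r -> ccvg (u i) (l i)) ->
  ccvg (fun n => \prod_(i <- r) u i n) (\prod_(i <- r) l i).
Proof.
elim: r => [|i r IH] ul.
  under eq_fun => n do rewrite big_nil.
  by rewrite big_nil; exact: ccvg_cst.
under eq_fun => n do rewrite big_cons.
rewrite big_cons; apply: ccvgM; first by apply: ul; rewrite inE eqxx.
by apply: IH => j jr; apply: ul; rewrite inE jr orbT.
Qed.

Lemma ccvg_unique u l l' : ccvg u l -> ccvg u l' -> l = l'.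
Proof.
move=> [u1 u2] [v1 v2]; case: l l' u1 u2 v1 v2 => [a b] [a' b'] /= u1 u2 v1 v2.
congr Complex.
  by rewrite -(cvg_lim (@Rhausdorff R) u1) -(cvg_lim (@Rhausdorff R) v1).
by rewrite -(cvg_lim (@Rhausdorff R) u2) -(cvg_lim (@Rhausdorff R) v2).
Qed.

Lemma ccvg_shift N u l : ccvg (fun n => u (n + N)%N) l -> ccvg u l.
Proof.
move=> [u1 u2]; split.
  by rewrite -(cvg_shiftn N).
by rewrite -(cvg_shiftn N).
Qed.

Lemma eq_ccvg N u v l :
  (forall n, (N <= n)%N -> u n = v n) -> ccvg u l -> ccvg v l.
Proof.
move=> uv [u1 u2]; split.
  apply: cvg_trans u1; apply: near_eq_cvg; near=> n; rewrite uv //.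
  by near: n; exists N.
apply: cvg_trans u2; apply: near_eq_cvg; near=> n; rewrite uv //.
by near: n; exists N.
Unshelve. all: by end_near. Qed.

Lemma ccvg_real (x : nat -> R) (l : R[i]) : ccvg (fun n => (x n)%:C%C) l ->
  x n @[n --> \oo] --> Re l /\ l = (Re l)%:C%C.
Proof.
move=> [/= x1 x2]; split => //; case: l x1 x2 => [a b] /= _ x2.
by rewrite -(cvg_lim (@Rhausdorff R) x2) lim_cst.
Qed.

(** The relative increments are dominated by those of the null sequence [e], so
    [normc (u n) * expR (e n)] decreases and [u] is bounded by some [B]; then each
    component plus [B * e n] decreases and is bounded below. *)
Lemma ccvg_slow_shift (u : nat -> R[i]) (e : nat -> R) :
  (forall n, 0 <= e n) -> (forall n, e n.+1 <= e n) ->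
  e n @[n --> \oo] --> 0 ->
  (forall n, normc (u n.+1 - u n) <= (e n - e n.+1) * normc (u n)) ->
  exists l, ccvg u l.
Proof.
move=> e0 edec ecv ue; pose B := normc (u 0) * expR (e 0).
have uexp n : normc (u n) * expR (e n) <= B.
  elim: n => [|n IH]; first exact: lexx.
  apply: le_trans IH.
  have h1 : normc (u n.+1) <= normc (u n) * expR (e n - e n.+1).
    apply: (@le_trans _ _ (normc (u n) * (1 + (e n - e n.+1)))).
      have -> : u n.+1 = u n + (u n.+1 - u n) by ring.
      apply: le_trans (normcD _ _) _; rewrite mulrDr mulr1 lerD2l.
      by rewrite [leRHS]mulrC ue.
    by apply: ler_wpM2l; rewrite ?normc_ge0 // expR_ge1Dx.
  have := ler_wpM2r (expR_ge0 (e n.+1)) h1.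
  by rewrite -mulrA -expRD subrK.
have uB n : normc (u n) <= B.
  apply: le_trans (uexp n); rewrite ler_peMr ?normc_ge0 // -expR0 ler_expR.
  exact: e0.
have B0 : 0 <= B by rewrite (le_trans (normc_ge0 (u 0)) (uB 0)).
have real (x : nat -> R) : (forall n, `|x n| <= B) ->
    (forall n, `|x n.+1 - x n| <= B * (e n - e n.+1)) ->
    exists a : R, x n @[n --> \oo] --> a.
  move=> xB dx; pose y n := x n + B * e n.
  have ycv : cvgn y.
    apply: nonincreasing_is_cvgn.
      apply/nonincreasing_seqP => n; rewrite /y.
      by have := le_trans (ler_norm _) (dx n); lra.
    exists (- B) => _ [n _ <-]; rewrite /y.
    have := xB n; rewrite ler_norml => /andP[h _].
    by have := mulr_ge0 B0 (e0 n); lra.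
  exists (limn y - B * 0).
  rewrite (_ : x = (fun n => y n - B * e n)).
    by apply: cvgB => //; apply: cvgMr.
  by apply/funext => n; rewrite /y addrK.
have due n : normc (u n.+1 - u n) <= B * (e n - e n.+1).
  by rewrite mulrC (le_trans (ue n)) // ler_wpM2l ?subr_ge0.
have [||a ac] := real (fun n => Re (u n)).
- by move=> n; apply: le_trans (Re_le_normc _) _.
- by move=> n; rewrite -raddfB; apply: le_trans (Re_le_normc _) _.
have [||b bc] := real (fun n => Im (u n)).
- by move=> n; apply: le_trans (Im_le_normc _) _.
- by move=> n; rewrite -raddfB; apply: le_trans (Im_le_normc _) _.
by exists (Complex a b).
Qed.

Lemma cvg_cst_div (K : R) N : K / (n + N.+1)%:R @[n --> \oo] --> 0.
Proof.
rewrite -[X in _ --> X](mulr0 K); apply: cvgMr.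
have := @cvg_harmonic R; rewrite -(cvg_shiftn N).
apply: cvg_trans; apply: near_eq_cvg; near=> n.
by rewrite /harmonic addnS.
Unshelve. all: by end_near. Qed.

(** The dominating null sequence is [2 K / n], because
    [1 / n ^ 2 <= 2 (1 / n - 1 / (n + 1))]. *)
Lemma ccvg_slow (u : nat -> R[i]) (K : R) N : 0 <= K ->
  (forall n, (N < n)%N ->
     normc (u n.+1 - u n) <= K / n%:R ^+ 2 * normc (u n)) ->
  exists l, ccvg u l.
Proof.
move=> K0 uK.
pose e n : R := 2 * K / (n + N.+1)%:R.
have [||||l lc] := @ccvg_slow_shift (fun n => u (n + N.+1)%N) e.
- by move=> n; rewrite /e divr_ge0 // mulr_ge0.
- move=> n; rewrite /e ler_wpM2l ?mulr_ge0 // lef_pV2 ?posrE ?ltr0n ?addnS //.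
  by rewrite ler_nat; lia.
- exact: cvg_cst_div.
- move=> n; have Nn : (N < n + N.+1)%N by lia.
  apply: le_trans (uK (n + N.+1)%N Nn) _.
  apply: ler_wpM2r; first exact: normc_ge0.
  rewrite /e addSn; set p := (n + N.+1)%N.
  have p0 : 1 <= p%:R :> R by rewrite ler1n /p; lia.
  have -> : p.+1%:R = p%:R + 1 :> R by rewrite -natr1.
  rewrite -mulrBr -[2 * K]mulrC -mulrA ler_wpM2l //.
  have -> : 2 * (p%:R^-1 - (p%:R + 1)^-1) = 2 / (p%:R * (p%:R + 1)) :> R.
    by field; lra.
  rewrite ler_pdivlMr; last by nra.
  by rewrite mulrC ler_pdivrMr; nra.
by exists l; exact: (ccvg_shift lc).
Qed.

(** An infinite product with factors [1 + O(1 / n ^ 2)] converges, and so does the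
    product of the inverse factors; hence the limit is not 0. *)
Lemma ccvg_slow_quotient (u q : nat -> R[i]) (K : R) N : 0 <= K ->
  (forall n, (N < n)%N -> u n != 0) ->
  (forall n, (N < n)%N -> u n.+1 = u n * q n) ->
  (forall n, (N < n)%N -> normc (q n - 1) <= K / n%:R ^+ 2) ->
  exists l l', [/\ ccvg u l, ccvg (fun n => (u n)^-1) l' & l * l' = 1].
Proof.
move=> K0 u0 uq qK.
have [l lc] : exists l, ccvg u l.
  apply: (@ccvg_slow u K N) => // n Nn; rewrite uq //.
  have -> : u n * q n - u n = (q n - 1) * u n by ring.
  by rewrite Normc.normcM ler_wpM2r ?normc_ge0 ?qK.
pose M := maxn N (Num.truncn (2 * K)).+1.
have [l' lc'] : exists l', ccvg (fun n => (u n)^-1) l'.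
  apply: (@ccvg_slow _ (2 * K) M); first by rewrite mulr_ge0.
  move=> n Mn; have Nn : (N < n)%N by move: Mn; rewrite /M; lia.
  have n1 : 1 <= n%:R :> R by rewrite ler1n; lia.
  have nK : 2 * K <= n%:R.
    have : 2 * K < (Num.truncn (2 * K)).+1%:R by apply: truncnS_gt.
    move/ltW/le_trans; apply; rewrite ler_nat; move: Mn; rewrite /M; lia.
  have K2 : K / n%:R ^+ 2 <= 2^-1.
    by rewrite ler_pdivrMr ?exprn_gt0 ?expr2; nra.
  have q2 : 2^-1 <= normc (q n).
    have := normcD (q n) (- (q n - 1)); rewrite normcNE.
    have -> : q n - (q n - 1) = 1 by ring.
    by rewrite Normc.normc1; have := qK n Nn; lra.
  have q0 : q n != 0.
    apply/eqP => qn0; move: q2; rewrite qn0 Normc.normc0; lra.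
  rewrite uq //.
  have -> : (u n * q n)^-1 - (u n)^-1 = (- (q n - 1) / q n) / u n.
    by field; rewrite q0 u0.
  rewrite Normc.normcM; apply: ler_wpM2r; first exact: normc_ge0.
  rewrite Normc.normcM normcNE Normc.normcV ler_pdivrMr; last by lra.
  apply: le_trans (qK n Nn) _.
  have h : 0 <= K / n%:R ^+ 2 by rewrite divr_ge0 ?exprn_ge0.
  by rewrite -[2 * K / _]mulrA; nra.
exists l, l'; split => //.
apply: (ccvg_unique (ccvgM lc lc')).
apply: (@eq_ccvg N.+1 (fun=> 1)); last exact: ccvg_cst.
by move=> n Nn; rewrite divff // u0.
Qed.
End ComplexNorm.

(** * The complex exponential to second order *)

Section ComplexExp.
Variable R : realType.
Implicit Types (z w : R[i]).

Definition cexp w : R[i] :=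
  (expR (Re w))%:C%C * Complex (cos (Im w)) (sin (Im w)).

Lemma cexpD z w : cexp (z + w) = cexp z * cexp w.
Proof.
case: z w => [a b] [a' b']; rewrite /cexp /= expRD cosD sinD.
apply/eqP; rewrite eq_complex /= !mul0r !subr0 !addr0.
by apply/andP; split; apply/eqP; ring.
Qed.

Lemma cexp0 : cexp 0 = 1.
Proof. by rewrite /cexp /= expR0 cos0 sin0 mul1r. Qed.

Lemma cexp_neq0 z : cexp z != 0.
Proof.
apply/eqP => h; have := cexpD z (- z); rewrite h mul0r subrr cexp0 => /eqP.
by rewrite oner_eq0.
Qed.

Lemma cexp_sum (I : Type) (r : seq I) (F : I -> R[i]) :
  cexp (\sum_(i <- r) F i) = \prod_(i <- r) cexp (F i).
Proof. by elim/big_rec2: _ => [|i x y _ <-]; rewrite ?cexp0 ?cexpD. Qed.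

Lemma cexp_real (x : R) : cexp x%:C%C = (expR x)%:C%C.
Proof. by rewrite /cexp /= cos0 sin0 mulr1. Qed.

Lemma cpow_cexp (x : R) z : cpow x z = cexp (z * (ln x)%:C%C).
Proof. by rewrite /cpow /cexp ReM ImM /= !mulr0 subr0 add0r. Qed.

Lemma norm_sin_le (y : R) : `|sin y| <= `|y|.
Proof.
wlog y0 : y / 0 <= y => [H|].
  case: (leP 0 y) => y0; first exact: H.
  by rewrite -normrN -sinN -[leRHS]normrN; apply: H; lra.
have [c _ ] := @MVT_segment R sin cos 0 y y0 (fun x _ => is_derive_sin x)
  (continuous_subspaceT (@continuous_sin R)).
rewrite sin0 !subr0 => ->; rewrite normrM ler_piMl //.
exact: cos_max.
Qed.

Lemma cos_sub1_bound (y : R) : `|cos y - 1| <= y ^+ 2 / 2.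
Proof.
have -> : cos y - 1 = - (2 * sin (y / 2) ^+ 2).
  have {1}-> : y = y / 2 + y / 2 by field.
  rewrite cosD; have := cos2Dsin2 (y / 2); rewrite !expr2; nra.
rewrite normrN normrM normrX (ger0_norm (_ : 0 <= 2)) //.
have := norm_sin_le (y / 2); rewrite normrM (ger0_norm (_ : 0 <= 2^-1)) // => h.
have := real_normK (num_real y); have := normr_ge0 (sin (y / 2)); rewrite !expr2.
by have := normr_ge0 y; nra.
Qed.

Lemma sin_sub_bound (y : R) : `|y| <= 1 -> `|sin y - y| <= y ^+ 2.
Proof.
wlog y0 : y / 0 <= y => [H y1|].
  case: (leP 0 y) => y0; first exact: H.
  have := H (- y); rewrite sinN normrN sqrrN -opprD normrN.
  by apply => //; lra.
rewrite ger0_norm // => y1.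
have [c cy] := @MVT_segment R sin cos 0 y y0 (fun x _ => is_derive_sin x)
  (continuous_subspaceT (@continuous_sin R)).
rewrite sin0 !subr0 => ->.
have -> : cos c * y - y = y * (cos c - 1) by ring.
rewrite normrM ger0_norm // expr2 ler_wpM2l //.
apply: le_trans (cos_sub1_bound c) _.
by move: cy; rewrite in_itv /= => /andP[c0 c1]; nra.
Qed.

Lemma expR_sub1_bound (x : R) :
  `|x| <= 2^-1 -> 0 <= expR x - 1 - x <= 2 * x ^+ 2.
Proof.
(* The upper bound comes from expR x <= 1 / (1 - x). *)
rewrite ler_norml => /andP[x1 x2].
have h1 := expR_ge1Dx x; have h2 := expR_ge1Dx (- x).
apply/andP; split; first by lra.
have := expR_gt0 x; have : expR x * expR (- x) = 1 by rewrite -expRD subrr expR0.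
by rewrite expr2; nra.
Qed.

Lemma cexp_bound w :
  normc w <= 2^-1 -> normc (cexp w - 1 - w) <= 4 * normc w ^+ 2.
Proof.
move=> w2; rewrite normc_sqr.
have := le_trans (Re_le_normc w) w2; have := le_trans (Im_le_normc w) w2.
move=> b2 a2; apply: le_trans (normc_le_ReIm _) _; move: b2 a2.
case: w {w2} => [a b] /= b2 a2; rewrite !mul0r !subr0 !addr0.
have /andP[e1 e2] := expR_sub1_bound a2.
have c1 := cos_sub1_bound b; have s1 := @sin_sub_bound b ltac:(lra).
have e3 : expR a <= 2 by move: a2; rewrite ler_norml => /andP[]; nra.
have e4 := expR_gt0 a.
have Rb : `|expR a * cos b - 1 - a| <= 2 * a ^+ 2 + b ^+ 2.
  have -> : expR a * cos b - 1 - a =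
            (expR a - 1 - a) + expR a * (cos b - 1) by ring.
  apply: le_trans (ler_normD _ _) _; apply: lerD; first by rewrite ger0_norm.
  by rewrite normrM gtr0_norm //; have := normr_ge0 (cos b - 1); nra.
have Ib : `|expR a * sin b - b| <= 2 * b ^+ 2 + (a ^+ 2 + b ^+ 2).
  have -> : expR a * sin b - b =
            expR a * (sin b - b) + (expR a - 1) * b by ring.
  apply: le_trans (ler_normD _ _) _; apply: lerD.
    by rewrite normrM gtr0_norm //; have := normr_ge0 (sin b - b); nra.
  rewrite normrM.
  have h : `|expR a - 1| <= 2 * `|a|.
    have -> : expR a - 1 = (expR a - 1 - a) + a by ring.
    apply: le_trans (ler_normD _ _) _; rewrite ger0_norm //.
    have := normr_ge0 a; have := real_normK (num_real a); rewrite !expr2; nra.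
  have := real_normK (num_real a); have := real_normK (num_real b).
  have := normr_ge0 a; have := normr_ge0 b; rewrite !expr2.
  have := sqr_ge0 (`|a| - `|b|); rewrite !expr2; nra.
by have := sqr_ge0 a; have := sqr_ge0 b; lra.
Qed.
End ComplexExp.

(** * Convergence of Euler's product for the Gamma function *)

Section GammaLimit.
Variable R : realType.
Variable z : R[i].
Hypothesis zpole : forall i : nat, z + i%:R != 0.

Let dlog (n : nat) : R := ln n.+1%:R - ln n%:R.

Lemma dlog_bounds n : (0 < n)%N -> n.+1%:R^-1 <= dlog n <= n%:R^-1.
Proof.
move=> n0; have n1 : 0 < n%:R :> R by rewrite ltr0n.
have n2 : 0 < n.+1%:R :> R by rewrite ltr0n.
have E1 : n.+1%:R = n%:R * (1 + n%:R^-1) :> R.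
  by rewrite mulrDr mulr1 mulfV ?gt_eqF // natr1.
have E2 : n%:R = n.+1%:R * (1 + - n.+1%:R^-1) :> R.
  by rewrite mulrDr mulr1 mulrN mulfV ?gt_eqF // -natr1 addrK.
have i1 : 0 < n%:R^-1 :> R by rewrite invr_gt0.
have i2 : n.+1%:R^-1 < 1 :> R by rewrite invf_lt1 // ltr1n.
have l1 : ln (1 + - n.+1%:R^-1) <= - n.+1%:R^-1 :> R.
  by apply: le_ln1Dx; rewrite ltrN2.
have l2 : ln (1 + n%:R^-1) <= n%:R^-1 :> R.
  by apply: le_ln1Dx; rewrite (lt_trans _ i1) // ltrN10.
apply/andP; split; rewrite /dlog.
  rewrite [X in _ - ln X]E2 lnM ?posrE ?subr_gt0 //.
  by rewrite opprD addNKr lerNr.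
rewrite [X in ln X - _]E1 lnM ?posrE ?addr_gt0 //.
by rewrite addrAC subrr add0r.
Qed.

Let q (n : nat) : R[i] := n.+1%:R * cexp (z * (dlog n)%:C%C) / (z + n.+1%:R).

Lemma gamma_seqS n : gamma_seq z n.+1 = gamma_seq z n * q n.
Proof.
rewrite /gamma_seq /q !cpow_cexp factS natrM.
have -> : z * (ln n.+1%:R)%:C%C = z * (ln n%:R)%:C%C + z * (dlog n)%:C%C.
  by rewrite -mulrDr -rmorphD /dlog addrC subrK.
rewrite cexpD big_nat_recr //= invfM; ring.
Qed.

Lemma gamma_seq_neq0 n : gamma_seq z n != 0.
Proof.
rewrite /gamma_seq cpow_cexp; apply: mulf_neq0.
  apply: mulf_neq0; last exact: cexp_neq0.
  by rewrite pnatr_eq0 -lt0n fact_gt0.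
by rewrite invr_neq0 // prodf_seq_neq0; apply/allP => i _; rewrite zpole.
Qed.

(** [q n = (n + 1) exp (z * dlog n) / (z + n + 1)] and [dlog n] lies between
    [1 / (n + 1)] and [1 / n], so the terms of order [1 / n] cancel. *)
Lemma gamma_quotient_bound :
  exists2 K : R, 0 <= K & exists N, forall n, (N < n)%N ->
    normc (q n - 1) <= K / n%:R ^+ 2.
Proof.
set Z := normc z; have Z0 : 0 <= Z := normc_ge0 z.
exists (2 * (8 * Z ^+ 2 + Z)).
  by rewrite mulr_ge0 // addr_ge0 // mulr_ge0 ?exprn_ge0.
exists (Num.truncn (2 * Z)).+1 => n Nn.
have n0 : (0 < n)%N by lia.
have nZ : 2 * Z <= n%:R.
  have : 2 * Z < (Num.truncn (2 * Z)).+1%:R by apply: truncnS_gt.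
  by move/ltW/le_trans; apply; rewrite ler_nat; lia.
have n1 : 1 <= n%:R :> R by rewrite ler1n.
have nS : n.+1%:R = n%:R + 1 :> R by rewrite -natr1.
have /andP[d1 d2] := dlog_bounds n0.
set D := dlog n; set w := z * D%:C%C.
have D0 : 0 <= D by apply: le_trans d1; rewrite invr_ge0.
have nw : normc w <= Z / n%:R.
  by rewrite /w Normc.normcM normc_real ger0_norm // ler_wpM2l.
have w2 : normc w <= 2^-1.
  by apply: le_trans nw _; rewrite ler_pdivrMr; lra.
have wb : normc (cexp w - 1 - w) <= 4 * (Z / n%:R) ^+ 2.
  apply: le_trans (cexp_bound w2) _; rewrite ler_wpM2l //.
  by rewrite lerXn2r // nnegrE ?normc_ge0 // divr_ge0 //; lra.
have z1 := zpole n.+1.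
have den : n%:R / 2 <= normc (z + n.+1%:R).
  have := normcD (z + n.+1%:R) (- z); rewrite normcNE addrC addKr normc_nat nS -/Z.
  lra.
have -> : q n - 1 =
    (n.+1%:R * (cexp w - 1 - w) + z * (n.+1%:R * D%:C%C - 1)) /
    (z + n.+1%:R).
  rewrite /q -/D -/w; move: (cexp w) (n.+1%:R : R[i]) z1 => E N1 z1; rewrite /w.
  by field.
rewrite Normc.normcM Normc.normcV ler_pdivrMr; last by lra.
have num : normc (n.+1%:R * (cexp w - 1 - w) + z * (n.+1%:R * D%:C%C - 1)) <=
           (8 * Z ^+ 2 + Z) / n%:R.
  apply: le_trans (normcD _ _) _; rewrite mulrDl; apply: lerD.
    rewrite Normc.normcM normc_nat.
    apply: (@le_trans _ _ (n.+1%:R * (4 * (Z / n%:R) ^+ 2))).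
      by rewrite ler_wpM2l.
    have -> : n.+1%:R * (4 * (Z / n%:R) ^+ 2) =
              (4 * Z ^+ 2 / n%:R) * (n.+1%:R / n%:R).
      by field; lra.
    have -> : 8 * Z ^+ 2 / n%:R = (4 * Z ^+ 2 / n%:R) * 2 by field; lra.
    rewrite ler_wpM2l //; first by rewrite divr_ge0 ?mulr_ge0 ?exprn_ge0 //; lra.
    by rewrite ler_pdivrMr; lra.
  rewrite Normc.normcM ler_wpM2l //.
  have -> : n.+1%:R * D%:C%C - 1 = (n.+1%:R * D - 1)%:C%C :> R[i].
    rewrite -[in LHS](rmorph_nat (real_complex R)).
    by apply/eqP; rewrite eq_complex /= !(mulr0, mul0r, subr0, addr0) !eqxx.
  rewrite normc_real ger0_norm; last first.
    by rewrite subr_ge0 mulrC -ler_pdivrMr ?mul1r //; lra.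
  rewrite lerBlDr.
  apply: (@le_trans _ _ (n.+1%:R * n%:R^-1)); first by rewrite ler_wpM2l.
  by rewrite nS mulrDl mulfV; lra.
apply: le_trans num _.
apply: (@le_trans _ _ (2 * (8 * Z ^+ 2 + Z) / n%:R ^+ 2 * (n%:R / 2))); last first.
  rewrite ler_wpM2l // divr_ge0 ?exprn_ge0 // mulr_ge0 // addr_ge0 // mulr_ge0 ?exprn_ge0 //.
have -> // : 2 * (8 * Z ^+ 2 + Z) / n%:R ^+ 2 * (n%:R / 2) =
             (8 * Z ^+ 2 + Z) / n%:R.
by field; lra.
Qed.

(** Off the poles Euler's limit exists and, as the inverses converge too, it is
    not 0. *)
Lemma Gamma_limit : exists l', [/\ ccvg (gamma_seq z) (Gamma z),
  ccvg (fun n => (gamma_seq z n)^-1) l' & Gamma z * l' = 1].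
Proof.
have [K K0 [N qK]] := gamma_quotient_bound.
have [||l [l' [lc lc' ll']]] :=
  @ccvg_slow_quotient R (gamma_seq z) q K N K0 _ _ qK.
- by move=> n _; exact: gamma_seq_neq0.
- by move=> n _; exact: gamma_seqS.
have -> : Gamma z = l.
  case: lc => l1 l2; rewrite /Gamma (cvg_lim (@Rhausdorff R) l1).
  by rewrite (cvg_lim (@Rhausdorff R) l2); case: (l).
by exists l'.
Qed.
End GammaLimit.

(** * The root polynomials and the growth of the diagonal products *)

Definition diag_degree (smp : sampling_model) (m s : nat) : nat :=
  match smp with ModelM => minn s m | ModelR => s end.

Section DiagPoly.
Variables (F : fieldType) (d : nat) (a t : nat -> F).

(** [P_poly] and [Q_poly] both have this form, with [a = diag_coef] and
    [t = diag_shift]; evaluating at [n] gives [f_{n+1,s,s} * \prod_i (n + t_i)]. *)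
Definition diag_poly : {poly F} :=
  \sum_(l < d.+1) a l *: \prod_(l <= i < d) ('X + (t i)%:P).

Lemma prod_XaddC_coef (r : seq nat) (u : nat -> F) :
  let p := \prod_(i <- r) ('X + (u i)%:P) in
  [/\ size p = (size r).+1, p`_(size r) = 1 &
      (0 < size r)%N -> p`_(size r).-1 = \sum_(i <- r) u i].
Proof.
pose ps := [seq - u i | i <- r].
have -> : \prod_(i <- r) ('X + (u i)%:P) = \prod_(z <- ps) ('X - z%:P).
  by rewrite big_map; apply: eq_bigr => i _; rewrite polyCN opprK.
have sz : size ps = size r by rewrite size_map.
rewrite /= size_prod_XsubC sz; split => //.
  have := monic_prod_XsubC ps xpredT id; rewrite monicE /lead_coef size_prod_XsubC sz /=.
  by move/eqP.
move=> r0; rewrite -sz coefPn_prod_XsubC ?sz; last by rewrite -lt0n.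
by rewrite big_map -sumrN; apply: eq_bigr => i _; rewrite opprK.
Qed.

Lemma diag_poly_size : a 0 = 1 -> size diag_poly = d.+1 /\ lead_coef diag_poly = 1.
Proof.
move=> a0.
have [s0 c0 _] := prod_XaddC_coef (index_iota 0 d) t.
rewrite /= size_iota subn0 in s0 c0.
have sl (l : 'I_d) : (size (a (lift ord0 l) *:
    \prod_(lift ord0 l <= i < d) ('X + (t i)%:P)) <= d)%N.
  apply: leq_trans (size_scale_leq _ _) _.
  have [-> _ _] := prod_XaddC_coef (index_iota (lift ord0 l) d) t.
  by rewrite size_iota /=; have := ltn_ord l; rewrite /bump; lia.
have sS : (size (\sum_(l < d) a (lift ord0 l) *:
    \prod_(lift ord0 l <= i < d) ('X + (t i)%:P))%R <= d)%N.
  by apply: leq_trans (size_sum _ _ _) _; apply/bigmax_leqP => l _; exact: sl.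
rewrite /diag_poly big_ord_recl a0 scale1r.
move: s0 c0 sS; rewrite [X in (size X <= _)%N]/=.
move: (\prod_(0 <= i < d) _) (\sum_(l < d) _) => A B s0 c0 sS.
have sz : size (A + B) = d.+1 by rewrite size_polyDl s0.
split => //; rewrite /lead_coef sz coefD c0 [X in _ + X]nth_default ?addr0 //.
Qed.

(** Only [l = 0] and [l = 1] reach degree [d - 1]. *)
Lemma diag_poly_coef : a 0 = 1 -> (0 < d)%N ->
  diag_poly`_d.-1 = \sum_(0 <= i < d) t i + a 1.
Proof.
move=> a0 d0; rewrite /diag_poly coef_sum.
have [d' Ed] : exists d', d = d'.+1 by exists d.-1; lia.
rewrite Ed big_ord_recl big_ord_recl /= -Ed.
have [_ _ h0] := prod_XaddC_coef (index_iota 0 d) t.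
rewrite size_iota subn0 in h0.
have [_ h1 _] := prod_XaddC_coef (index_iota 1 d) t.
rewrite size_iota in h1.
rewrite !coefZ a0 mul1r -[d']/(d'.+1.-1) -Ed h0 //; congr (_ + _).
rewrite /bump /= -[d.-1]subn1 h1 mulr1 big1 ?addr0 // => l _.
rewrite coefZ nth_default ?mulr0 //.
have [-> _ _] := prod_XaddC_coef (index_iota (1 + (1 + l)) d) t.
by rewrite size_iota; have := ltn_ord l; lia.
Qed.

Lemma diag_poly_roots_sum (lam : nat -> F) : a 0 = 1 -> (0 < d)%N ->
  negated_roots diag_poly d lam ->
  \sum_(1 <= l < d.+1) lam l = \sum_(0 <= i < d) t i + a 1.
Proof.
move=> a0 d0 H; rewrite -diag_poly_coef // H.
have [_ _] := prod_XaddC_coef (index_iota 1 d.+1) lam.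
by rewrite size_iota subn1 => <-.
Qed.

Lemma diag_poly_eval x : (forall i, (i < d)%N -> x + t i != 0) ->
  diag_poly.[x] =
  (\sum_(l < d.+1) a l / \prod_(i < l) (x + t i)) * \prod_(i < d) (x + t i).
Proof.
move=> xt; rewrite /diag_poly horner_sum mulr_suml; apply: eq_bigr => l _.
rewrite hornerZ horner_prod -mulrA; congr (_ * _).
under eq_bigr => i _ do rewrite hornerD hornerX hornerC.
rewrite -!(big_mkord xpredT (fun i => x + t i)).
rewrite [X in _ = _ * X](big_cat_nat (n := l)) //=; last by have := ltn_ord l; lia.
rewrite mulKf // big_mkord prodf_seq_neq0; apply/allP => i _; apply/implyP => _.
by apply: xt; have := ltn_ord l; have := ltn_ord i; lia.
Qed.
End DiagPoly.

Lemma negated_roots_exist (F : closedFieldType) (p : {poly F}) d :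
  size p = d.+1 -> lead_coef p = 1 -> exists lam, negated_roots p d lam.
Proof.
move=> sp lp; have [r pr] := closed_field_poly_normal p.
rewrite lp scale1r in pr.
have sr : size r = d by move: sp; rewrite pr size_prod_XsubC => -[].
exists (fun l => - nth 0 r l.-1); rewrite /negated_roots {1}pr.
rewrite (big_nth 0) sr big_add1; apply: eq_bigr => i _.
by rewrite polyCN.
Qed.

Section RootPolys.
Variables (F : numFieldType) (m c sigma T0 s : nat).
Hypothesis hs : (0 < sigma)%N.

Lemma P_poly_diag : P_poly F m c sigma T0 s =
  diag_poly (minn s m) (diag_coef F m c sigma s) (diag_shift F ModelM sigma T0).
Proof.
rewrite /P_poly /diag_poly big_mkord scaler_sumr; apply: eq_bigr => l _.
set d := minn s m; have ld : (l <= d)%N by have := ltn_ord l; lia.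
have s0 : sigma%:R != 0 :> F by rewrite pnatr_eq0; lia.
have fs k : k`!%:R != 0 :> F by rewrite pnatr_eq0 -lt0n fact_gt0.
have -> : binom_poly ('X * sigma%:R%:P + T0%:R%:P - l%:R%:P : {poly F}) (d - l) =
   (sigma%:R ^+ (d - l) / (d - l)`!%:R) *:
   \prod_(l <= i < d) ('X + (diag_shift F ModelM sigma T0 i)%:P).
  rewrite /binom_poly [X in _ = X *: _]mulrC -scalerA; congr (_ *: _).
  have -> : \prod_(l <= i < d) ('X + (diag_shift F ModelM sigma T0 i)%:P) =
      \prod_(0 <= i < d - l)
        ('X + (diag_shift F ModelM sigma T0 (i + l))%:P) :> {poly F}.
    by rewrite -{1}[nat_of_ord l]add0n big_addn.
  have -> : sigma%:R ^+ (d - l) = \prod_(0 <= i < d - l) sigma%:R :> F.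
    by rewrite prodr_const_nat subn0.
  rewrite -scaler_prod; apply: eq_bigr => i _.
  rewrite scalerDr -!mul_polyC -polyCM /diag_shift.
  rewrite [sigma%:R * (_ / _)]mulrC divfK //.
  by rewrite natrD !polyCD !polyCN polyCD; ring.
rewrite !scalerA; congr (_ *: _); rewrite /diag_coef.
have bf : d`!%:R = 'C(d, l)%:R * (l`!%:R * (d - l)`!%:R) :> F.
  by rewrite -!natrM bin_fact.
have b0 : 'C(d, l)%:R != 0 :> F by rewrite pnatr_eq0 -lt0n bin_gt0.
have -> : sigma%:R ^+ d = sigma%:R ^+ l * sigma%:R ^+ (d - l) :> F.
  by rewrite -exprD subnKC.
rewrite bf; field.
by rewrite !expf_neq0 // !fs b0.
Qed.

Lemma Q_poly_diag : Q_poly F m c sigma T0 s =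
  diag_poly s (diag_coef F m c sigma s) (diag_shift F ModelR sigma T0).
Proof.
rewrite /Q_poly /diag_poly big_mkord scaler_sumr; apply: eq_bigr => l _.
have ld : (l <= s)%N by have := ltn_ord l; lia.
have s0 : sigma%:R != 0 :> F by rewrite pnatr_eq0; lia.
have -> : ('X * sigma%:R%:P + T0%:R%:P : {poly F}) ^+ (s - l) =
   sigma%:R ^+ (s - l) *:
   \prod_(l <= i < s) ('X + (diag_shift F ModelR sigma T0 i)%:P).
  rewrite /diag_shift prodr_const_nat -exprZn; congr (_ ^+ _).
  rewrite scalerDr -!mul_polyC -polyCM [sigma%:R * (_ / _)]mulrC divfK //.
  by rewrite mulrC.
rewrite !scalerA; congr (_ *: _); rewrite /diag_coef.
have -> : sigma%:R ^+ s = sigma%:R ^+ l * sigma%:R ^+ (s - l) :> F.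
  by rewrite -exprD subnKC.
by field; rewrite !expf_neq0.
Qed.
End RootPolys.

Section Asymptotics.
Variables (R : realType) (smp : sampling_model) (m c sigma T0 s : nat).
Hypotheses (hm : (1 <= m)%N) (hc : (0 < c)%N) (hs : (0 < sigma)%N).
Hypothesis hT : (m <= T0)%N.
Hypothesis s0 : (0 < s)%N.

Local Notation D := (diag_prod R smp m c sigma T0).
Local Notation f := (f_coef R smp m c sigma T0).
Local Notation d := (diag_degree smp m s).
Local Notation a F := (diag_coef F m c sigma s).
Local Notation t F := (diag_shift F smp sigma T0).

Definition root_poly : {poly R[i]} := diag_poly d (a R[i]) (t R[i]).

Lemma diag_degree_gt0 : (0 < d)%N.
Proof. by rewrite /diag_degree; case: smp; lia. Qed.

Lemma diag_shift_gt0 i : (i < d)%N -> 0 < t R i.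
Proof.
move=> id; rewrite /diag_shift; move: id; rewrite /diag_degree.
case: smp => id; rewrite divr_gt0 ?ltr0n //; last by lia.
by rewrite subr_gt0 ltr_nat; lia.
Qed.

Lemma diag_shiftC i : t R[i] i = (t R i)%:C%C.
Proof.
rewrite /diag_shift; case: smp; rewrite fmorph_div ?rmorphB !rmorph_nat //.
Qed.

Lemma diag_coefC l : a R[i] l = (a R l)%:C%C.
Proof. by rewrite /diag_coef fmorph_div !rmorphM !rmorphXn !rmorph_nat. Qed.

Lemma diag_coef0 (F : fieldType) : a F 0 = 1.
Proof. by rewrite /diag_coef !bin0 fact0 !expr0 !mulr1 divr1. Qed.

Lemma diag_coef1 : a R 1 = s%:R * Lambda R m c sigma.
Proof. by rewrite /diag_coef !bin1 !expr1 /Lambda natrM !mulr1; ring. Qed.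

(** Without replacement, the terms with [l > m] vanish. *)
Lemma f_diag_degree n :
  f n.+1 s s = \sum_(l < d.+1) a R l / \prod_(i < l) (n%:R + t R i).
Proof.
rewrite f_diag_a //.
rewrite (@big_ord_widen _ _ _ d.+1 s.+1 (fun l =>
  a R l / \prod_(i < l) (n%:R + t R i))); last first.
  by rewrite /diag_degree; case: smp; lia.
rewrite [RHS]big_mkcond; apply: eq_bigr => l _; case: ifP => // ld.
rewrite /diag_coef (bin_small (n := m)) ?(mul0r, mulr0) //.
by have := ltn_ord l; move: ld; rewrite /diag_degree; case: smp; lia.
Qed.

Lemma root_poly_f n : root_poly.[n%:R] =
  (f n.+1 s s)%:C%C * \prod_(i < d) (n%:R + t R[i] i).
Proof.
rewrite /root_poly diag_poly_eval; last first.
  move=> i id; rewrite diag_shiftC -(rmorph_nat (real_complex R)) -rmorphD.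
  by rewrite fmorph_eq0 gt_eqF // ltr_wpDl // diag_shift_gt0.
congr (_ * _); rewrite f_diag_degree rmorph_sum; apply: eq_bigr => l _.
rewrite fmorph_div rmorph_prod diag_coefC; congr (_ / _); apply: eq_bigr => i _.
by rewrite rmorphD rmorph_nat diag_shiftC.
Qed.

Section Roots.
Variable lam : nat -> R[i].
Hypothesis Hlam : negated_roots root_poly d lam.

Lemma shift_pole l i : (l < d)%N -> t R[i] l + i%:R != 0.
Proof.
move=> ld; rewrite diag_shiftC -(rmorph_nat (real_complex R)) -rmorphD.
by rewrite fmorph_eq0 gt_eqF // ltr_wpDr // diag_shift_gt0.
Qed.

Lemma root_poly_eval (n : nat) :
  root_poly.[n%:R] = \prod_(1 <= l < d.+1) (lam l + n%:R).
Proof.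
rewrite Hlam horner_prod; apply: eq_bigr => l _.
by rewrite hornerD hornerX hornerC addrC.
Qed.

Lemma prod_roots_neq0 n : \prod_(1 <= l < d.+1) (lam l + n%:R) != 0.
Proof.
rewrite -root_poly_eval root_poly_f mulf_neq0 //.
  by rewrite fmorph_eq0 gt_eqF // (lt_le_trans ltr01) // f_diag_ge1.
by apply/prodf_neq0 => i _; rewrite addrC shift_pole.
Qed.

(** [f_{i+1,s,s} >= 1], so no natural number [i] is a root: each [lam l] is off the
    poles of the Gamma function. *)
Lemma root_pole l i : (0 < l <= d)%N -> lam l + i%:R != 0.
Proof.
move=> ld; apply: contraNneq (prod_roots_neq0 i) => l0.
by rewrite (bigD1_seq l) ?iota_uniq ?mem_index_iota //= l0 mul0r.
Qed.

(** [D s (n + 1)] is the product over [l] of the quotients of the rising products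
    of [lam l] and of [t_{l-1}]; the powers of [n] combine to the exponent
    [\sum t - \sum lam = - a_1], which is [- s * Lambda]. *)
Lemma prod_gamma_seq n :
  \prod_(1 <= l < d.+1) (gamma_seq (t R[i] l.-1) n * (gamma_seq (lam l) n)^-1) =
  (D s n.+1 * expR (- (s%:R * Lambda R m c sigma) * ln n%:R))%:C%C.
Proof.
have Dn : (D s n.+1)%:C%C = \prod_(1 <= l < d.+1)
    (\prod_(0 <= i < n.+1) (lam l + i%:R) /
     \prod_(0 <= i < n.+1) (t R[i] l.-1 + i%:R)).
  rewrite prodf_div exchange_big [X in _ / X]exchange_big /= -prodf_div.
  rewrite /diag_prod rmorph_prod big_add1; apply: eq_bigr => i _.
  rewrite -root_poly_eval root_poly_f big_add1 /= big_mkord.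
  have P0 : \prod_(l < d) (i%:R + t R[i] l) != 0.
    by apply/prodf_neq0 => l _; rewrite addrC shift_pole.
  under [X in _ / X]eq_bigr => l _ do rewrite addrC.
  by rewrite mulfK.
have En : (expR (- (s%:R * Lambda R m c sigma) * ln n%:R))%:C%C =
   \prod_(1 <= l < d.+1) (cpow n%:R (t R[i] l.-1) / cpow n%:R (lam l)).
  rewrite prodf_div; under eq_bigr => l _ do rewrite cpow_cexp.
  under [X in _ / X]eq_bigr => l _ do rewrite cpow_cexp.
  rewrite -!cexp_sum -!mulr_suml.
  rewrite (diag_poly_roots_sum (diag_coef0 _) diag_degree_gt0 Hlam).
  rewrite diag_coefC diag_coef1 [X in cexp (X * _) / _]big_add1 /=.
  set S := \sum_(0 <= i < d) _.
  apply: (mulIf (cexp_neq0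
    ((S + (s%:R * Lambda R m c sigma)%:C%C) * (ln n%:R)%:C%C))).
  rewrite divfK ?cexp_neq0 // -cexp_real -cexpD; congr cexp.
  by rewrite rmorphM rmorphN; ring.
transitivity ((D s n.+1)%:C%C *
  (expR (- (s%:R * Lambda R m c sigma) * ln n%:R))%:C%C);
  last by rewrite -rmorphM.
rewrite En Dn -big_split /=; rewrite big_nat_cond [RHS]big_nat_cond.
apply: eq_bigr => l /andP[/andP[l1 l2] _].
rewrite /gamma_seq.
have p1 : \prod_(0 <= i < n.+1) (lam l + i%:R) != 0.
  by rewrite prodf_seq_neq0; apply/allP => i _; rewrite root_pole //; lia.
have p2 : \prod_(0 <= i < n.+1) (t R[i] l.-1 + i%:R) != 0.
  by rewrite prodf_seq_neq0; apply/allP => i _; rewrite shift_pole //; lia.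
have p3 : n`!%:R != 0 :> R[i] by rewrite pnatr_eq0 -lt0n fact_gt0.
have p4 : cpow n%:R (lam l) != 0 by rewrite cpow_cexp cexp_neq0.
by field; rewrite p1 p2 p3 p4.
Qed.

Definition gamma_ratio : R[i] :=
  \prod_(1 <= l < d.+1) (Gamma (t R[i] l.-1) / Gamma (lam l)).

Lemma gamma_ratio_limit :
  D s n.+1 * expR (- (s%:R * Lambda R m c sigma) * ln n%:R)
    @[n --> \oo] --> Re gamma_ratio /\
  gamma_ratio = (Re gamma_ratio)%:C%C.
Proof.
apply: ccvg_real; apply: (@eq_ccvg _ 0 (fun n => \prod_(1 <= l < d.+1)
  (gamma_seq (t R[i] l.-1) n * (gamma_seq (lam l) n)^-1))).
  by move=> n _; rewrite prod_gamma_seq.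
apply: ccvg_prod => l; rewrite mem_index_iota => ld.
have [_ [tc _ _]] :=
  @Gamma_limit R (t R[i] l.-1) (fun i => @shift_pole l.-1 i ltac:(lia)).
have [g [_ gc g1]] := @Gamma_limit R (lam l) (fun i => @root_pole l i ld).
apply: ccvgM => //.
have -> // : (Gamma (lam l))^-1 = g.
have g0 : Gamma (lam l) != 0.
  by apply: contra_eq_neq g1 => ->; rewrite mul0r eq_sym oner_eq0.
by apply: (mulfI g0); rewrite g1 divff.
Qed.
End Roots.

Lemma cvg_dlog :
  expR (- (s%:R * Lambda R m c sigma) * (ln n.+1%:R - ln n%:R))
    @[n --> \oo] --> (1 : R).
Proof.
rewrite -[X in _ --> X](@expR0 R); apply: continuous_cvg; first exact: continuous_expR.
rewrite -[X in _ --> X](mulr0 (- (s%:R * Lambda R m c sigma))); apply: cvgMr.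
apply: (@squeeze_cvgr _ _ _ _ (fun=> 0) (fun n : nat => n%:R^-1 : R)).
- near=> n; have n0 : (0 < n)%N by near: n; exists 1%N.
  have /andP[h1 ->] := dlog_bounds R n0; rewrite andbT.
  by apply: le_trans h1; rewrite invr_ge0.
- exact: cvg_cst.
- by rewrite -(cvg_shiftS (fun n : nat => n%:R^-1 : R)); exact: cvg_harmonic.
Unshelve. all: by end_near. Qed.

Lemma diag_prod_limit (g : R) :
  D s n.+1 * expR (- (s%:R * Lambda R m c sigma) * ln n%:R) @[n --> \oo] --> g ->
  D s n / (n%:R `^ Lambda R m c sigma) ^+ s @[n --> \oo] --> g.
Proof.
move=> Dg; rewrite -(cvg_shiftS (fun n : nat =>
  D s n / (n%:R `^ Lambda R m c sigma) ^+ s)).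
rewrite -[g]mulr1.
rewrite (_ : (fun n => D s n.+1 / _) = (fun n => D s n.+1 *
  expR (- (s%:R * Lambda R m c sigma) * ln n%:R) *
  expR (- (s%:R * Lambda R m c sigma) * (ln n.+1%:R - ln n%:R)))).
  by apply: cvgM => //; exact: cvg_dlog.
apply/funext => n; rewrite -mulrA -expRD -mulrDr addrC subrK; congr (_ * _).
rewrite /powR ifF; last by rewrite pnatr_eq0.
by rewrite -expRM_natl -expRN; congr expR; ring.
Qed.

(** The complex numbers are algebraically closed, so some list of roots exists and
    yields the real limit; any other list yields the same one. *)
Lemma diag_prod_cvg : exists g : R,
  D s n / (n%:R `^ Lambda R m c sigma) ^+ s @[n --> \oo] --> g /\
  forall lam, negated_roots root_poly d lam -> g%:C%C = gamma_ratio lam.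
Proof.
have [sz lc] :=
  @diag_poly_size R[i] d (a R[i]) (t R[i]) (diag_coef0 R[i]).
have [lam0 H0] := negated_roots_exist sz lc.
have [c0 _] := gamma_ratio_limit H0.
exists (Re (gamma_ratio lam0)); split; first exact: diag_prod_limit.
move=> lam H; have [c1 ->] := gamma_ratio_limit H.
by rewrite -(cvg_lim (@Rhausdorff R) c0) -(cvg_lim (@Rhausdorff R) c1).
Qed.
End Asymptotics.

(** * Limits of the coefficients and of the normalised moments *)

Lemma cvg_sumr (R : realType) (I : eqType) (r : seq I) (P : pred I)
    (u : I -> nat -> R) (l : I -> R) :
  (forall i, i \in r -> P i -> u i n @[n --> \oo] --> l i) ->
  \sum_(i <- r | P i) u i n @[n --> \oo] --> \sum_(i <- r | P i) l i.
Proof.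
elim: r => [|i r IH] ul.
  under eq_fun => n do rewrite big_nil.
  by rewrite big_nil; exact: cvg_cst.
have IH' := IH (fun j jr => ul j (mem_behead (s := i :: r) jr)).
under eq_fun => n do rewrite big_cons.
rewrite big_cons; case: ifP => // Pi.
by apply: cvgD => //; apply: ul; rewrite // mem_head.
Qed.

Section Limits.
Variables (R : realType) (smp : sampling_model) (m c sigma T0 : nat).
Hypotheses (hm : (1 <= m)%N) (hc : (0 < c)%N) (hs : (0 < sigma)%N).
Hypothesis hT : (m <= T0)%N.

Local Notation jmp := (jump R smp m c sigma T0).
Local Notation term := (phi_lim_term R smp m c sigma T0).

(** [chain_sum jmp n s h] runs over the decreasing tuples bounded by [n]; the sum
    over all of them converges absolutely by [chain_sum_bound]. *)
Lemma chain_sum_limit t s (h : seq nat) l : is_composition t h -> (t <= s)%N ->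
  size h = l ->
  summable [set i : l.-tuple nat | is_decreasing i]
    (fun i => (chain_weight jmp s h i)%:E) /\
  chain_sum jmp n s h @[n --> \oo] -->
    unordered_sum [set i : l.-tuple nat | is_decreasing i]
      (fun i : l.-tuple nat => chain_weight jmp s h i).
Proof.
move=> ht ts hl.
have [|||M M0 HM] := @chain_sum_bound R (fun a b n => `|jmp a b n|)
  (f_bound R m c) _ _ _ t s h ht ts.
- by [].
- exact: f_bound_ge0.
- by move=> a b n ba; exact: sum_jump_bound.
have uM n : \sum_(i : l.-tuple 'I_n.+1 | is_decreasing (map val i))
    `|chain_weight jmp s h (map val i)| <= M.
  under eq_bigr => i _ do rewrite chain_weight_norm.
  by rewrite sum_chain_weight //; case/andP: (HM n).
have [h1 h2] := @cvg_sum_decreasing R l (chain_weight jmp s h) M uM.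
split => //; move: h2.
by under eq_fun => n do rewrite (@sum_chain_weight _ _ n s h l) //.
Qed.

Lemma phi_lim_term_limit t s (h : seq nat) l : is_composition t h -> (t <= s)%N ->
  (0 < l)%N -> size h = l ->
  summable [set i : l.-tuple nat | is_decreasing i]
    (fun i => (term s h i)%:E) /\
  chain_sum jmp n s h @[n --> \oo] -->
    unordered_sum [set i : l.-tuple nat | is_decreasing i]
      (fun i : l.-tuple nat => term s h i).
Proof.
move=> ht ts l0 hl; have [h1 h2] := chain_sum_limit ht ts hl.
have E (i : l.-tuple nat) : is_decreasing i -> term s h i = chain_weight jmp s h i.
  by move=> di; apply: phi_lim_term_weight; rewrite ?size_tuple.
split.
  rewrite /summable (_ : esum _ _ =
    \esum_(i in [set i : l.-tuple nat | is_decreasing i])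
      `|(chain_weight jmp s h i)%:E|)%E //.
  by apply: eq_esum => i /= di; rewrite E.
rewrite (_ : unordered_sum _ _ =
  unordered_sum [set i : l.-tuple nat | is_decreasing i]
    (fun i : l.-tuple nat => chain_weight jmp s h i)) //.
rewrite /unordered_sum; congr (fine (_ - _)); apply: eq_esum => i /= di.
  by rewrite !funeposE /= E.
by rewrite !funenegE /= E.
Qed.

Definition phi_limit_sum (s k : nat) : R :=
  \sum_(1 <= l < (s - k).+1)
    \sum_(h : l.-tuple 'I_(s - k).+1 | is_composition (s - k) (map val h))
      unordered_sum [set i : l.-tuple nat | is_decreasing i]
        (fun i => term s (map val h) i).

Lemma psi_limit s k : (k < s)%N ->
  psi R smp m c sigma T0 n s k @[n --> \oo] --> phi_limit_sum s k.
Proof.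
move=> ks; rewrite /psi /phi_limit_sum.
under eq_fun => n do rewrite big_compositions_tuple ?subn_gt0 //.
apply: cvg_sumr => l; rewrite mem_index_iota => /andP[l1 l2] _.
apply: cvg_sumr => h _ hh.
have [] := @phi_lim_term_limit (s - k) s (map val h) l hh; rewrite ?leq_subr //.
by rewrite size_map size_tuple.
Qed.

Lemma phi_ratio n s k : (k <= s)%N ->
  phi R smp m c sigma T0 n s k / phi R smp m c sigma T0 n s s =
  psi R smp m c sigma T0 n s k.
Proof.
move=> ks; rewrite !phi_psi // {2}/psi subnn compositions0 big_seq1 mulr1.
by rewrite mulrAC divff ?mul1r // diag_prod_neq0.
Qed.

Lemma psi_diag n s : psi R smp m c sigma T0 n s s = 1.
Proof. by rewrite /psi subnn compositions0 big_seq1. Qed.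

Lemma phi_ratio_cvg s k : (k <= s)%N ->
  phi R smp m c sigma T0 n s k / phi R smp m c sigma T0 n s s
    @[n --> \oo] -->
  phi_lim R smp m c sigma T0 s k.
Proof.
move=> ks; suff : cvgn (fun n =>
  phi R smp m c sigma T0 n s k / phi R smp m c sigma T0 n s s) by [].
under eq_fun => n do rewrite phi_ratio //.
move: ks; rewrite leq_eqVlt => /predU1P[->|ks].
  under eq_fun => n do rewrite psi_diag.
  exact: is_cvg_cst.
by apply/cvg_ex; exists (phi_limit_sum s k); exact: psi_limit.
Qed.

Lemma phi_lim_diag s : phi_lim R smp m c sigma T0 s s = 1.
Proof.
rewrite /phi_lim; under eq_fun => n do rewrite phi_ratio // psi_diag.
by rewrite lim_cst.
Qed.

Lemma phi_limE s k :
  (k < s)%N -> phi_lim R smp m c sigma T0 s k = phi_limit_sum s k.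
Proof.
move=> ks; have h1 := phi_ratio_cvg (ltnW ks); have h2 := psi_limit ks.
rewrite -(cvg_lim (@Rhausdorff R) h1) -(cvg_lim (@Rhausdorff R) h2).
by congr (lim (_ @ \oo)); apply/funext => n; rewrite phi_ratio // ltnW.
Qed.
End Limits.

Theorem theorem2 (R : realType) (smp : sampling_model)
    (m c sigma W0 B0 : nat)
    (hm : (1 <= m)%N) (hc : (0 < c)%N) (hsigma : (m * c <= sigma)%N)
    (hT0 : (m <= W0 + B0)%N)
    (d : measure_display) (Omega : measurableType d)
    (P : probability Omega R) (K : nat -> {RV P >-> nat})
    (hK : urn_draws smp m c sigma W0 B0 K) :
  let T0 := (W0 + B0)%N in
  let W := fun (n : nat) (omega : Omega) =>
    ((urn m c sigma W0 B0 (fun i => K i omega) n).1)%:R : R in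
  let L := Lambda R m c sigma in
  let ph := phi R smp m c sigma T0 in
  let phl := phi_lim R smp m c sigma T0 in
  forall s : nat, (1 <= s)%N ->
    (forall n : nat,
       'E_P[fun omega => (W n omega ^+ s)%R]%E =
       (\sum_(1 <= k < s.+1) ph n s k * W0%:R ^+ k)%:E)
    /\
    (exists Es : R,
       'E_P[fun omega => ((W n omega / n%:R `^ L) ^+ s)%R]%E @[n --> \oo] --> Es%:E
       /\
       match smp with
       | ModelM =>
           forall lam : nat -> R[i],
             negated_roots (P_poly R[i] m c sigma T0 s) (minn s m) lam ->
             Es%:C%C =
             (\prod_(1 <= l < (minn s m).+1)
                (Gamma ((T0%:R + 1 - l%:R) / sigma%:R) / Gamma (lam l))) *
             (\sum_(1 <= k < s.+1) phl s k * W0%:R ^+ k)%:C%C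
       | ModelR =>
           forall mu : nat -> R[i],
             negated_roots (Q_poly R[i] m c sigma T0 s) s mu ->
             Es%:C%C =
             Gamma (T0%:R / sigma%:R) ^+ s /
             (\prod_(1 <= l < s.+1) Gamma (mu l)) *
             (\sum_(1 <= k < s.+1) phl s k * W0%:R ^+ k)%:C%C
       end)
    /\
    (forall k : nat, (1 <= k <= s)%N ->
       cvgn (fun n => ph n s k / ph n s s))
    /\
    phl s s = 1
    /\
    (forall k : nat, (1 <= k <= s - 1)%N ->
       (forall (l : nat) (h : l.-tuple 'I_(s - k).+1), (1 <= l <= s - k)%N ->
          is_composition (s - k) (map val h) ->
          summable [set i : l.-tuple nat | is_decreasing i]
            (fun i => (phi_lim_term R smp m c sigma T0 s (map val h) i)%:E))
       /\
       phl s k =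
       \sum_(1 <= l < (s - k).+1)
         \sum_(h : l.-tuple 'I_(s - k).+1 | is_composition (s - k) (map val h))
           unordered_sum [set i : l.-tuple nat | is_decreasing i]
             (fun i => phi_lim_term R smp m c sigma T0 s (map val h) i)).
Proof.
move=> T0 W L ph phl s s0.
have sg0 : (0 < sigma)%N by apply: leq_trans hsigma; rewrite muln_gt0 hm.
have moment n : white_mean smp m c sigma W0 B0 n (fun w => w%:R ^+ s) =
    \sum_(1 <= k < s.+1) ph n s k * W0%:R ^+ k by exact: white_mean_expr.
split=> [n|].
  rewrite -moment.
  apply: (expectation_white hsigma hK n (g := fun w => w%:R ^+ s)) => w.
  by rewrite exprn_ge0.
split; last split.
- have [g [gc gl]] := diag_prod_cvg R smp hm hc sg0 hT0 s0.
  exists (g * \sum_(1 <= k < s.+1) phl s k * W0%:R ^+ k); split.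
    have E n : 'E_P[fun omega => ((W n omega / n%:R `^ L) ^+ s)%R]%E =
      (diag_prod R smp m c sigma T0 s n / (n%:R `^ L) ^+ s *
        \sum_(1 <= k < s.+1) (ph n s k / ph n s s) * W0%:R ^+ k)%:E.
      transitivity (white_mean smp m c sigma W0 B0 n
        (fun w => (w%:R / n%:R `^ L) ^+ s))%:E.
        apply: (expectation_white hsigma hK n
          (g := fun w => (w%:R / n%:R `^ L) ^+ s)) => w.
        by rewrite exprn_ge0 // divr_ge0 // powR_ge0.
      congr EFin.
      (* The one-term sum brings the constant factor into the scope of linearity. *)
      transitivity (white_mean smp m c sigma W0 B0 n
        (fun w => \sum_(i <- [:: tt]) ((n%:R `^ L) ^+ s)^-1 * w%:R ^+ s)).
        by apply: eq_white_mean => // w _; rewrite big_seq1 expr_div_n mulrC.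
      rewrite white_mean_sum // big_seq1 moment.
      rewrite [in RHS]mulrAC [in LHS]mulrC; congr (_ / _).
      rewrite mulr_sumr big_nat_cond [RHS]big_nat_cond.
      apply: eq_bigr => k /andP[/andP[k1 k2] _].
      by rewrite /ph phi_ratio // phi_psi // mulrA.
    under eq_fun => n do rewrite E.
    apply: cvg_EFin; first by near=> n.
    apply: cvgM => //; apply: cvg_sumr => k.
    rewrite mem_index_iota => /andP[k1 k2] _.
    by apply: cvgMl; exact: phi_ratio_cvg.
  have Eg lam : negated_roots (root_poly R smp m c sigma T0 s)
                  (diag_degree smp m s) lam ->
      (g * \sum_(1 <= k < s.+1) phl s k * W0%:R ^+ k)%:C%C =
      gamma_ratio smp m sigma T0 s lam *
      (\sum_(1 <= k < s.+1) phl s k * W0%:R ^+ k)%:C%C.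
    by move=> H; rewrite -(gl _ H) -rmorphM.
  move: Eg; rewrite /gamma_ratio /root_poly /diag_degree; case: {+}smp => Eg lam H.
    rewrite (Eg lam); last by rewrite -P_poly_diag.
    congr (_ * _).
    have E l : (0 < l)%N -> (T0%:R + 1 - l%:R) / sigma%:R =
                            diag_shift R[i] ModelM sigma T0 l.-1.
      case: l => // l _; rewrite /diag_shift /=.
      by rewrite -natr1 opprD addrACA subrr addr0.
    rewrite big_nat_cond [RHS]big_nat_cond.
    apply: eq_bigr => l /andP[/andP[l1 l2] _].
    by rewrite E.
  rewrite (Eg lam); last by rewrite -Q_poly_diag.
  congr (_ * _).
  rewrite prodf_div; congr (_ / _).
  by rewrite /diag_shift prodr_const_nat subn1.
- by move=> k /andP[k1 k2]; apply/cvg_ex; exists (phl s k); exact: phi_ratio_cvg.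
split; first exact: phi_lim_diag.
move=> k /andP[k1 k2]; have ks : (k < s)%N by lia.
split; last exact: phi_limE.
move=> l h /andP[l1 l2] hh.
by have [] := phi_lim_term_limit R smp hm hc sg0 hT0 hh (leq_subr k s) l1
  (size_tuple (map_tuple val h)).
Unshelve. all: by end_near. Qed.
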